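(* Let $(\mathcal{M},\tau)$ be a non-commutative probability space, let $X\in\mathcal{M}$ be self-adjoint with symmetric law $\mu$, and let $B\in\mathcal{M}$ be self-adjoint, Boolean independent from $X$ and distributed according to $\mathrm{b}=\frac12\delta_{-1}+\frac12\delta_{1}$. Fix $t\ge 0$ such that $\Gamma(X+\sqrt{s}B)<\infty$ and $\Psi(X+\sqrt{s}B)<+\infty$ for every $s\in[0,t]$. Then $$\Gamma(X+\sqrt{t}B)-\Gamma(X)=\int_0^t\frac12\,\Psi(X+\sqrt{s}B)\,ds.$$ In particular, $\Gamma(X+\sqrt{t}B)$ is increasing with respect to $t$.
   Context: A non-commutative probability space $(\mathcal{M},\tau)$ is a von Neumann algebra $\mathcal{M}$ with a nondegenerate normal state $\tau$, not necessarily faithful. For self-adjoint $A\in\mathcal{M}$, the law of $A$ is the unique probability measure $\mu$ on $\mathbb{R}$ with $\tau(A^k)=\int x^k\,d\mu(x)$ for all $k\in\mathbb{N}$. Two self-adjoint $X,Y\in\mathcal{M}$ are Boolean independent if for all finite sequences of integers $k_1,k_2,\ldots\ge 1$, $\tau(X^{k_1}Y^{k_2}X^{k_3}\cdots)=\tau(X^{k_1})\tau(Y^{k_2})\tau(X^{k_3})\cdots$ and $\tau(Y^{k_1}X^{k_2}Y^{k_3}\cdots)=\tau(Y^{k_1})\tau(X^{k_2})\tau(Y^{k_3})\cdots$. For a self-adjoint $X$ with law $\mu$, the Boolean entropy is $\Gamma(X)=\int\log|x|\,d\mu(x)\in[-\infty,+\infty)$. For $X$ with symmetric law $\mu$, the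 Boolean Fisher information is $\Psi(X)=\iint\frac{\log x^2-\log y^2}{x^2-y^2}\,d\mu(x)\,d\mu(y)\in(0,+\infty]$, where the integrand is understood with its continuous extension on the diagonal $x^2=y^2$ (value $1/x^2$, and $+\infty$ if $x=0$ or $y=0$). If $X$ and $B$ have symmetric laws and are Boolean independent, then $X+\sqrt{s}B$ also has symmetric law. *)

(* Defs.v *)
From HB Require Import structures.
From mathcomp Require Import all_boot all_order all_algebra.
From mathcomp Require Import complex.
From mathcomp Require Import all_classical all_reals all_analysis.

Set Implicit Arguments.
Unset Strict Implicit.
Unset Printing Implicit Defensive.

Import Order.TTheory GRing.Theory Num.Theory.
Import numFieldNormedType.Exports.

Local Open Scope classical_set_scope.
Local Open Scope ring_scope.
Local Open Scope complex_scope.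

(* A Hilbert space is a complete normed module H over R[i] whose norm is
   induced by an inner product, linear in its first argument. *)
Definition norm_induced_by (R : realType) (H : completeNormedModType R[i])
    (dot : {dot H for Num.conj}) : Prop :=
  forall x : H, `|x| ^+ 2 = dot x x.

Section VonNeumannAlgebra.
Variables (R : realType) (H : completeNormedModType R[i]).
Variable dot : {dot H for Num.conj}.
Implicit Types (A B C S T : H -> H) (M D : set (H -> H)).

Definition bounded_operator A : Prop := linear A /\ continuous A.

Definition adjoint A B : Prop := forall x y : H, dot (A x) y = dot x (B y).

Definition selfadjoint A : Prop := adjoint A A.

Definition commutant M : set (H -> H) :=
  [set A | bounded_operator A /\ forall B, M B -> A \o B =1 B \o A].

(* A self-adjoint set of bounded operators that is its own bicommutant. Being
   a unital subalgebra of the bounded operators is a consequence of the second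
   conjunct. *)
Definition von_neumann_algebra M : Prop :=
  (forall A, M A -> exists2 B, M B & adjoint A B) /\
  commutant (commutant M) = M.

(* The Loewner order, for self-adjoint operators; the order on R[i] compares
   only numbers with the same imaginary part. *)
Definition op_le A B : Prop := forall x : H, dot (A x) x <= dot (B x) x.

Definition selfadjoint_part M : set (H -> H) := [set A | M A /\ selfadjoint A].

Definition op_directed D : Prop :=
  forall A B, D A -> D B -> exists C, [/\ D C, op_le A C & op_le B C].

Definition op_supremum M D S : Prop :=
  [/\ selfadjoint_part M S,
      forall A, D A -> op_le A S &
      forall T, selfadjoint_part M T ->
        (forall A, D A -> op_le A T) -> op_le S T].

(* Functionals on M are total functions whose values outside M are
   irrelevant. *)
Implicit Type tau : (H -> H) -> R[i].

Definition state M tau : Prop :=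
  [/\ forall (a : R[i]) A B, M A -> M B ->
        tau (a *: A + B) = a * tau A + tau B,
      forall A B, M A -> M B -> adjoint A B -> 0 <= tau (B \o A) &
      tau id = 1].

Definition normal M tau : Prop :=
  forall D S, D !=set0 -> D `<=` selfadjoint_part M -> op_directed D ->
    op_supremum M D S -> supremums [set tau A | A in D] (tau S).

(* Faithfulness of the GNS representation of tau, which is weaker than
   faithfulness of tau. *)
Definition nondegenerate M tau : Prop :=
  forall A, M A ->
    (forall B C, M B -> M C -> tau (B \o A \o C) = 0) -> A =1 cst 0.

Definition nc_probability_space M tau : Prop :=
  [/\ norm_induced_by dot, von_neumann_algebra M, state M tau,
      normal M tau & nondegenerate M tau].

End VonNeumannAlgebra.

Section BooleanProbability.
Variables (R : realType) (H : completeNormedModType R[i]).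
Variable tau : (H -> H) -> R[i].
Implicit Types (A B X Y : H -> H) (ks : seq nat).

Notation borelR := (measurableTypeR R).

Definition is_law A (mu : probability borelR R) : Prop :=
  forall k : nat, mu.-integrable setT (fun x : borelR => (x ^+ k)%:E) /\
    tau (iter k A) = (\int[mu]_x (x ^+ k))%:C.

(* For a self-adjoint A in the algebra such a measure exists and is unique, so
   the choice made by [get] is immaterial. *)
Definition law A : probability borelR R := get (is_law A).

(* X ^ k1 \o Y ^ k2 \o X ^ k3 \o ... for ks = [:: k1; k2; k3; ...] *)
Fixpoint alternating_word X Y ks : H -> H :=
  if ks is k :: ks' then iter k X \o alternating_word Y X ks' else id.

Fixpoint alternating_moments X Y ks : R[i] :=
  if ks is k :: ks' then tau (iter k X) * alternating_moments Y X ks' else 1.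

Definition boolean_independent X Y : Prop :=
  forall ks, all (leq 1) ks ->
    tau (alternating_word X Y ks) = alternating_moments X Y ks /\
    tau (alternating_word Y X ks) = alternating_moments Y X ks.

Definition symmetric_distribution (mu : probability borelR R) : Prop :=
  forall U : set borelR, measurable U -> mu (-%R @^-1` U) = mu U.

Definition symmetric_bernoulli_distribution (mu : probability borelR R) : Prop :=
  forall U : set borelR, measurable U ->
    (mu U = (2^-1)%:E * \d_((-1)%R : R) U + (2^-1)%:E * \d_(1%R : R) U)%E.

(* lne 0 = -oo *)
Definition boolean_entropy A : \bar R := (\int[law A]_x lne (`|x|%:E))%E.

Definition fisher_kernel (x y : R) : \bar R :=
  if (x == 0) || (y == 0) then +oo%E
  else if x ^+ 2 == y ^+ 2 then ((x ^+ 2)^-1)%:E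
  else ((ln (x ^+ 2) - ln (y ^+ 2)) / (x ^+ 2 - y ^+ 2))%:E.

Definition boolean_fisher A : \bar R :=
  (\int[law A \x law A]_z fisher_kernel z.1 z.2)%E.

End BooleanProbability.

(* Main.v *)
(* Write X_s = X + sqrt s B and mu_s for its law, and for l > 0 put
   h_s(l) = \int (l + x^2)^-1 dmu_s(x). Boolean independence, the symmetry of
   mu_0 and tau(w B B) = tau(w) for every word w make the law of X_s^2 that of
   a rank one perturbation of X^2, that is 1 / h_s = 1 / h_0 + s. Hence
   (d/ds) h_s = - h_s^2. On the other hand
     fisher_kernel x y = \int_0^oo dl / ((l + x^2) (l + y^2)), and
     ln N - ln x^2 = \int_0^oo ((l + x^2)^-1 - (l + N)^-1) dl for x^2 <= N,
   so by Tonelli the Fisher information of X_s is \int_0^oo h_s(l)^2 dl and its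
   entropy is (ln N - \int_0^oo (h_s(l) - (l + N)^-1) dl) / 2 when [- sqrt N, sqrt N]
   carries mu_s. Integrating the differential equation in s and applying Tonelli
   once more gives the formula. The integrand of the entropy is at most N h_s^2,
   so that a finite Fisher information forces a finite entropy.

   The law of a self-adjoint A in M exists because, T being an affine image of A
   with 0 <= T <= 1, the numbers tau(T^k (1 - T)^j) are nonnegative and solve
   the Hausdorff moment problem. *)
From HB Require Import structures.
Require Import Defs.
From mathcomp Require Import all_boot all_order all_algebra.
From mathcomp Require Import complex ring lra zify.
From mathcomp Require Import all_classical all_reals all_analysis measurable_realfun.

Import Order.TTheory GRing.Theory Num.Theory.
Import numFieldNormedType.Exports.

Local Open Scope classical_set_scope.
Local Open Scope ring_scope.
Local Open Scope complex_scope.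

Set Implicit Arguments.
Unset Strict Implicit.
Unset Printing Implicit Defensive.

(** * The Hausdorff moment problem *)

(** [law] is a choice among measures with given moments, so nothing can be said about a law until
    such a measure has been produced; hence the start with a moment problem. Resolvents of operators
    are never formed. With C = N - X^2 and N above the squared support, (l + X^2)^-1 is a geometric
    series in (l + N)^-1 whose coefficients tau(C^j) are nonnegative. Independence is then applied
    to polynomials only, and the resolvent identity becomes a recursion between nonnegative
    sequences. The rank one structure appears under [tau]: in the square of X + r B the mixed terms
    contribute 0, while B B between a polynomial and a power of C splits the state into a product,
    as the projection onto the state vector would. *)

Section RiemannSums.
Context {R : realType}.
Notation leb := (@lebesgue_measure R).

Lemma nondecreasing_integrable (g : R -> R) (a b : R) :
  nondecreasing_fun g -> leb.-integrable `[a, b] (EFin \o g).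
Proof.
move=> gnd; apply: measurable_bounded_integrable => //.
- rewrite /= lebesgue_measure_itv/=; case: ifP => // _.
  by rewrite -EFinB ltry.
- exact: nondecreasing_measurable.
exists (Num.max `|g a| `|g b|); split; first exact: num_real.
move=> x Mx t /=; rewrite in_itv/= => /andP[at_ tb].
apply: le_trans (ltW Mx).
have h1 := gnd _ _ at_; have h2 := gnd _ _ tb.
by rewrite le_max; case: (lerP 0 (g t)) => gt0;
  [apply/orP; right; rewrite (ger0_norm gt0) (le_trans h2)// ler_norm
  |apply/orP; left; rewrite (ltr0_norm gt0) -[X in _ <= X]normrN (le_trans _ (ler_norm _))// lerN2].
Qed.

Lemma riemann_sum_le_integral (g : R -> R) (h : R) (n : nat) :
  0 < h -> nondecreasing_fun g ->
  \sum_(i < n) g (i%:R * h) * h <= \int[leb]_(x in `[0, n%:R * h]) g x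
    <= \sum_(i < n) g (i.+1%:R * h) * h.
Proof.
move=> h0 gnd; elim: n => [|n /andP[IH1 IH2]].
  by rewrite !big_ord0 mul0r set_itv1 Rintegral_set1 lexx.
rewrite !big_ord_recr/=.
have nh : n%:R * h <= n.+1%:R * h by rewrite ler_pM2r// ler_nat.
have nh0 : 0 <= n%:R * h by rewrite mulr_ge0// ltW.
have gi := nondecreasing_integrable 0 (n.+1%:R * h) gnd.
have := @Rintegral_itvB R g (BLeft 0) (BRight (n.+1%:R * h)) (n%:R * h) gi.
rewrite !bnd_simp => /(_ nh0 nh)/eqP; rewrite subr_eq => /eqP ->.
have gi' : leb.-integrable `]n%:R * h, n.+1%:R * h] (EFin \o g).
  by apply: integrableS gi => //; apply: subset_itvr; rewrite bnd_simp.
have ci r : leb.-integrable `]n%:R * h, n.+1%:R * h] (EFin \o cst r).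
  apply: integrableS (@nondecreasing_integrable (cst r) 0 (n.+1%:R * h) _) => //.
  by apply: subset_itvr; rewrite bnd_simp.
have lebE r : \int[leb]_(x in `]n%:R * h, n.+1%:R * h]) r = r * h.
  rewrite Rintegral_cst//= lebesgue_measure_itv/= lte_fin ltr_pM2r// ltr_nat ltnS leqnn.
  by rewrite -EFinB/= -mulrBl -natrB// subSnn mul1r.
rewrite [X in _ <= X <= _]addrC; apply/andP; split.
  rewrite lerD// -(lebE (g _)); apply: (@le_Rintegral _ _ _ leb _ (cst _) g) => //; move=> x /=.
  by rewrite in_itv/= => /andP[/ltW xn _]; exact: gnd.
rewrite lerD// -(lebE (g _)); apply: (@le_Rintegral _ _ _ leb _ g (cst _)) => //; move=> x /=.
by rewrite in_itv/= => /andP[_ xn]; exact: gnd.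
Qed.

(** Upper and lower sums differ only in their extreme terms, so the error sees [g] only through
    [g 1 - g 0]. The bound is thus common to all monotone functions with values in [0, 1]. *)
Lemma riemann_sum_error (g : R -> R) (n : nat) : nondecreasing_fun g ->
  `|\int[leb]_(x in `[0, 1]) g x - \sum_(i < n.+1) g (i%:R / n.+1%:R) / n.+1%:R|
    <= (g 1 - g 0) / n.+1%:R.
Proof.
move=> gnd.
have n0 : 0 < n.+1%:R^-1 :> R by rewrite invr_gt0 ltr0n.
have /andP[] := riemann_sum_le_integral n.+1 n0 gnd.
rewrite mulfV ?pnatr_eq0// => h1 h2.
rewrite ger0_norm ?subr_ge0//.
apply: (@le_trans _ _ (\sum_(i < n.+1) g (i.+1%:R / n.+1%:R) / n.+1%:R -
   \sum_(i < n.+1) g (i%:R / n.+1%:R) / n.+1%:R)); first by rewrite lerD2r.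
rewrite big_ord_recr/= [X in _ - X]big_ord_recl/= mulfV ?pnatr_eq0// mul0r.
by rewrite mulrBl; under [X in _ - (_ + X)]eq_bigr do rewrite /bump leq0n add1n; rewrite (addrC (\sum_(i < n) _)) opprD addrACA subrr addr0.
Qed.

End RiemannSums.

Section StepFunctions.
Context {R : realType}.
Notation leb := (@lebesgue_measure R).

Lemma step_integral (c0 : R) (c w : nat -> R) (n : nat) :
  (forall k, 0 <= w k <= 1) ->
  leb.-integrable `[0, 1]
    (EFin \o (fun u : R => c0 + \sum_(k < n) c k * (w k <= u)%R%:R)) /\
  \int[leb]_(u in `[0, 1]) (c0 + \sum_(k < n) c k * (w k <= u)%R%:R) =
    c0 + \sum_(k < n) c k * (1 - w k).
Proof.
move=> w01.
have i1 k : leb.-integrable `[0, 1] (EFin \o (fun u : R => (w k <= u)%R%:R : R)).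
  apply: nondecreasing_integrable => x y xy; rewrite ler_nat.
  by case: (leP (w k) x) => // /le_trans/(_ xy) ->.
have i2 k : leb.-integrable `[0, 1] (EFin \o (fun u : R => c k * (w k <= u)%R%:R : R)).
  rewrite (_ : _ \o _ = (fun u => (c k)%:E * ((EFin \o (fun u : R => (w k <= u)%R%:R : R)%R) u))%E) //.
  exact: integrableZl.
have v1 k : \int[leb]_(u in `[0, 1]) (w k <= u)%R%:R = 1 - w k.
  have /andP[wk0 wk1] := w01 k.
  rewrite (_ : (fun u => _) = \1_(`[w k, +oo[%classic) :> (R -> R)); last first.
    by apply/funext => u; rewrite indicE mem_setE in_itv/= andbT.
  rewrite /Rintegral integral_indic//.
  rewrite (_ : _ `&` _ = `[w k, 1]%classic); last first.
    apply/seteqP; split => u /=; rewrite !in_itv/= ?andbT.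
      by move=> [-> /andP[_ ->]].
    by move=> /andP[h1 h2]; rewrite h1 h2 (le_trans wk0 h1).
  rewrite /= lebesgue_measure_itv/= lte_fin; case: ltP => // h.
  by apply/eqP; rewrite eq_sym subr_eq0 eq_le h.
elim: n => [|n [IH1 IH2]].
  rewrite (_ : (fun u : R => _) = cst c0); last first.
    by apply/funext => u; rewrite big_ord0 addr0.
  split; first exact: (@nondecreasing_integrable R (cst c0)).
  by rewrite Rintegral_cst//= lebesgue_measure_itv/= lte_fin ltr01 big_ord0 oppr0 addr0 mulr1 addr0.
have e : (fun u : R => c0 + \sum_(k < n.+1) c k * (w k <= u)%R%:R) =
  (fun u => (c0 + \sum_(k < n) c k * (w k <= u)%R%:R) + c n * (w n <= u)%R%:R).
  by apply/funext => u; rewrite big_ord_recr/= addrA.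
rewrite e; split.
  rewrite (_ : _ \o _ = ((EFin \o (fun u : R => c0 + \sum_(k < n) c k * (w k <= u)%R%:R)%R) \+
    (EFin \o (fun u : R => c n * (w n <= u)%R%:R)%R))%E) //.
  exact: integrableD.
by rewrite RintegralD// IH2 RintegralZl// v1 big_ord_recr/= addrA.
Qed.

(** Because [w] is nondecreasing, the [k] with [w k <= u] form an initial segment, over which the
    increments of [g] telescope. The right side has the form that [step_integral] integrates. *)
Lemma comp_count (g w : nat -> R) (n : nat) (u : R) :
  {homo w : i j / (i <= j)%N >-> i <= j} ->
  g (\sum_(k < n) (w k <= u)%R)%N =
  g 0%N + \sum_(k < n) (g k.+1 - g k) * (w k <= u)%R%:R.
Proof.
move=> wnd; elim: n => [|n IH]; first by rewrite !big_ord0 addr0.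
rewrite !big_ord_recr/=; case: (leP (w n) u) => [wu|_]; last first.
  by rewrite addn0 mulr0 addr0.
have countE : (\sum_(k < n) (w k <= u)%R = n)%N.
  under eq_bigr do rewrite (le_trans (wnd _ _ (ltnW (ltn_ord _))) wu).
  by rewrite sum_nat_const card_ord muln1.
by move: IH; rewrite countE addn1 mulr1 addrA => <-; rewrite addrC subrK.
Qed.

(** Summation by parts. For weights [p] of total 1 it turns the integral of a step function that
    jumps at the cumulative sums of [p] into the mean of [g] under [p]. *)
Lemma abel_sum (g p : nat -> R) (n : nat) :
  \sum_(k < n) (g k.+1 - g k) * (\sum_(j < n.+1) p j - \sum_(j < k.+1) p j) =
  \sum_(k < n.+1) g k * p k - g 0%N * \sum_(j < n.+1) p j.
Proof.
elim: n => [|n IH]; first by rewrite big_ord0 !big_ord1 subrr.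
rewrite big_ord_recr/= [X in _ + _ * (X - _)]big_ord_recr/= (addrC _ (p n.+1)) addrK.
under eq_bigr => i _.
  rewrite [X in _ * (X - _)]big_ord_recr/= addrAC mulrDr; over.
rewrite big_split/= IH -mulr_suml -addrA -mulrDl -(big_ord_recr n (fun k => g k.+1 - g k)).
have -> : \sum_(i < n.+1) (g i.+1 - g i) = g n.+1 - g 0%N.
  by rewrite -(big_mkord xpredT (fun i => g i.+1 - g i)) telescope_sumr.
rewrite [X in _ = X - _]big_ord_recr/= [X in _ = _ - _ * X]big_ord_recr/=.
by ring.
Qed.

End StepFunctions.

Section HausdorffMoments.
Context {R : realType}.
Variable c : nat -> nat -> R.
Hypothesis cD : forall k j, c k j = c k.+1 j + c k j.+1.

(** If [c k j] is read as the integral of x^k (1 - x)^j, then [cD] says x + (1 - x) = 1, and this is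
    the expansion of (x + (1 - x))^n times x^a (1 - x)^j. *)
Lemma hausdorff_binomial (n a j : nat) :
  \sum_(k < n.+1) 'C(n, k)%:R * c (a + k) (j + (n - k)) = c a j.
Proof.
elim: n a j => [|n IH] a j; first by rewrite big_ord1 bin0 mul1r addn0 subn0 addn0.
rewrite cD -(IH a.+1 j) -(IH a j.+1).
rewrite big_ord_recl big_ord_recr/= !bin0 !binn subn0 addn0 subnn addn0.
under eq_bigr => i _.
  rewrite /bump leq0n add1n binS natrD mulrDl subSS; over.
rewrite big_split/= [X in _ = X + _]big_ord_recr/= [X in _ = _ + X]big_ord_recl/=.
rewrite bin0 binn subn0 addn0 subnn addn0 !addnS addSn !addSnnS.
under [X in _ = _ + (_ + X)]eq_bigr => i _.
  rewrite /bump leq0n add1n; over.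
under [X in _ = (X + _) + _]eq_bigr => i _ do rewrite addSnnS.
rewrite [X in _ + (X + _ + _)](_ : _ = 
  \sum_(i < n) 'C(n, i.+1)%:R * c (a + i.+1) (j.+1 + (n - i.+1))); last first.
  by apply: eq_bigr => i _; rewrite addSnnS -subSn.
by rewrite !mul1r addnS; ring.
Qed.

(** Since k^_m C(n, k) = n^_m C(n - m, k - m), the factorial moments of the binomial weights
    reproduce [c] exactly; the approximation enters only with ordinary powers, in
    [ffact_ratio_error]. *)
Lemma hausdorff_ffact (n m a j : nat) :
  \sum_(k < n.+1) (k ^_ m)%:R * ('C(n, k)%:R * c (a + k) (j + (n - k))) =
  (n ^_ m)%:R * c (a + m) j.
Proof.
elim: m n a => [|m IH] n a.
  under eq_bigr do rewrite ffactn0 mul1r.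
  by rewrite hausdorff_binomial ffactn0 mul1r addn0.
case: n => [|n]; first by rewrite big_ord1 !ffact0n !mul0r.
rewrite big_ord_recl ffact0n mul0r add0r.
rewrite ffactSS natrM -mulrA addnS -addSn -IH mulr_sumr.
apply: eq_bigr => k _; rewrite lift0 ffactSS subSS addnS addSn.
have /(congr1 (fun x => x%:R : R)) := mul_bin_diag n.+1 k.
rewrite !natrM /= => e.
transitivity ((k ^_ m)%:R * (k.+1%:R * 'C(n.+1, k.+1)%:R) * c (a + k).+1 (j + (n - k))).
  by ring.
by rewrite -e; ring.
Qed.

(** Both terms are products of [m] factors in [0, 1], so the errors of the factors add up; (k - i) /
    (n - i) differs from k / n by at most i / n. *)
Lemma ffact_ratio_error (n k m : nat) : (m <= n)%N -> (k <= n)%N ->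
  `|(k ^_ m)%:R / (n ^_ m)%:R - (k%:R / n%:R) ^+ m| <= (m * m)%:R / n%:R :> R.
Proof.
move=> + kn; elim: m => [|m IH] mn.
  by rewrite !ffactn0 expr0 divr1 subrr normr0 mul0r.
have n0 : (0 < n)%N by apply: leq_trans mn.
have nm0 : (0 < n - m)%N by rewrite subn_gt0.
have r0 : 0 < n%:R :> R by rewrite ltr0n.
have rm0 : 0 < (n - m)%:R :> R by rewrite ltr0n.
rewrite !ffactnSr !natrM invfM mulrACA exprSr.
set x := _ / (n ^_ m)%:R; set y := _ ^+ m.
set a := _ / (n - m)%:R; set b := _ / n%:R.
have b01 : 0 <= b <= 1.
  by rewrite /b divr_ge0//= ler_pdivrMr// mul1r ler_nat.
have a01 : 0 <= a <= 1.
  by rewrite /a divr_ge0//= ler_pdivrMr// mul1r ler_nat leq_sub2r.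
have y01 : 0 <= y <= 1 by case/andP: b01 => *; rewrite exprn_ge0//= exprn_ile1.
have ab : `|a - b| <= m%:R / n%:R.
  (* For [k < m] truncated subtraction makes [a] vanish, and [b] itself is below m / n. *)
  rewrite /a /b; case: (leqP m k) => mk.
    have -> : (k - m)%:R / (n - m)%:R - k%:R / n%:R = 
      - ((m%:R / n%:R) * ((n - k)%:R / (n - m)%:R)) :> R.
      rewrite !natrB//; last exact: ltnW.
      field; rewrite gt_eqF ?(gt_eqF r0)// subr_gt0 ltr_nat.
      exact: mn.
    rewrite normrN ger0_norm; last by rewrite !mulr_ge0// invr_ge0.
    apply: ler_piMr; first by rewrite divr_ge0.
    by rewrite ler_pdivrMr// mul1r ler_nat leq_sub2l.
  have -> : (k - m = 0)%N by apply/eqP; rewrite subn_eq0 ltnW.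
  rewrite mul0r sub0r normrN ger0_norm ?divr_ge0//.
  by rewrite ler_pM2r ?invr_gt0// ler_nat ltnW.
have -> : x * a - y * b = (x - y) * a + y * (a - b) by ring.
apply: (le_trans (ler_normD _ _)); rewrite (normrM (x - y)) (normrM y) -natrM.
have h1 : `|x - y| * `|a| <= (m * m)%:R / n%:R.
  case/andP: a01 => a0 a1; apply: le_trans (IH (ltnW mn)).
  by rewrite (ger0_norm a0) ler_piMr.
have h2 : `|y| * `|a - b| <= m%:R / n%:R.
  case/andP: y01 => y0 y1; apply: le_trans ab.
  by rewrite (ger0_norm y0) ler_piMl.
apply: (le_trans (lerD h1 h2)); rewrite -mulrDl ler_pM2r ?invr_gt0// -natrD ler_nat.
by lia.
Qed.

End HausdorffMoments.

Lemma ultra_fmap (T U : Type) (f : T -> U) (F : set_system T) :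
  UltraFilter F -> UltraFilter (f @ F).
Proof.
move=> UF; have FP : ProperFilter F by exact: ultra_proper.
split; first exact: fmap_proper_filter.
move=> H HP FH; apply/seteqP; split=> [A HA|A]; last exact: FH.
have [//|FnA] := in_ultra_setVsetC (f @^-1` A) UF.
have HnA : H (~` A) by apply: FH.
by have [x [Ax /(_ Ax)]] := filter_ex (filterI HA HnA).
Qed.

Section HausdorffMomentProblem.
Context {R : realType}.
Notation leb := (@lebesgue_measure R).
Variable c : nat -> nat -> R.
Hypothesis c_ge0 : forall k j, 0 <= c k j.
Hypothesis cD : forall k j, c k j = c k.+1 j + c k j.+1.
Hypothesis c00 : c 0%N 0%N = 1.

(** [W n k] is the mass that the weights [p n] put on the points before k / n, and [N n u] is the
    first index whose cumulative mass exceeds [u], capped at [n]. Hence [Qn n] transports Lebesgue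
    measure on [0, 1] to the discrete law. *)
Let p (n k : nat) : R := 'C(n, k)%:R * c k (n - k).
Let W (n k : nat) : R := \sum_(j < k) p n j.
Let N (n : nat) (u : R) : nat := (\sum_(k < n) (W n k.+1 <= u)%R)%N.
Let Qn (n : nat) (u : R) : R := (N n u)%:R / n%:R.

Let p_ge0 n k : 0 <= p n k. Proof. by rewrite mulr_ge0. Qed.

Let W_total n : W n n.+1 = 1.
Proof.
by rewrite -c00 -(hausdorff_binomial cD n 0 0); apply: eq_bigr => k _; rewrite add0n.
Qed.

Let W_homo n : {homo W n : i j / (i <= j)%N >-> i <= j}.
Proof.
move=> i j /subnKC <-; rewrite /W -!(big_mkord xpredT (p n)).
by rewrite [leRHS](big_cat_nat (leq0n i)) ?leq_addr//= lerDl sumr_ge0.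
Qed.

Let W01 n k : 0 <= W n k <= 1.
Proof.
rewrite {1}/W sumr_ge0//=; case: (leqP k n.+1) => kn.
  by rewrite -(W_total n) W_homo.
rewrite -(W_total n) /W -!(big_mkord xpredT (p n)) [leLHS](big_cat_nat (leq0n n.+1) (ltnW kn))//=.
rewrite gerDl big_nat big1// => i /andP[ni _].
by rewrite /p bin_small// mul0r.
Qed.

Let N_le n u : (N n u <= n)%N.
Proof.
rewrite /N (leq_trans (n := \sum_(k < n) 1))%N//.
  by apply: leq_sum => i _; case: (_ <= _).
by rewrite sum_nat_const card_ord muln1.
Qed.

Let Qn01 n u : 0 <= Qn n u <= 1.
Proof.
rewrite /Qn; case: n => [|n]; first by rewrite invr0 mulr0 lexx ler01.
by rewrite divr_ge0//= ler_pdivrMr// mul1r ler_nat.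
Qed.

Let Qn_homo n : nondecreasing_fun (Qn n).
Proof.
move=> u v uv; rewrite ler_wpM2r// ?invr_ge0// ler_nat leq_sum// => k _.
by case: (leP _ u) => // /le_trans/(_ uv) ->.
Qed.

Let Qn_moment n m : \int[leb]_(u in `[0, 1]) Qn n u ^+ m =
  \sum_(k < n.+1) (k%:R / n%:R) ^+ m * p n k.
Proof.
pose g (k : nat) : R := (k%:R / n%:R) ^+ m.
have -> : (fun u => Qn n u ^+ m) =
    (fun u : R => g 0%N + \sum_(k < n) (g k.+1 - g k) * (W n k.+1 <= u)%R%:R).
  apply/funext => u; rewrite -(@comp_count _ g (fun k => W n k.+1))// => i j ij.
  exact: W_homo.
have [_ ->] := step_integral (g 0%N) (fun k => g k.+1 - g k) n (fun k => W01 n k.+1).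
have := abel_sum g (p n) n; rewrite -/(W n n.+1) W_total => e.
by rewrite e mulr1 addrC subrK.
Qed.

Let Qn_moment_error n m : (m <= n)%N ->
  `|\int[leb]_(u in `[0, 1]) Qn n u ^+ m - c m 0| <= (m * m)%:R / n%:R.
Proof.
move=> mn; rewrite Qn_moment.
have fnm : (n ^_ m)%:R != 0 :> R by rewrite pnatr_eq0 -lt0n ffact_gt0.
have -> : c m 0 = \sum_(k < n.+1) (k ^_ m)%:R / (n ^_ m)%:R * p n k.
  have /(congr1 (fun x => x / (n ^_ m)%:R)) := hausdorff_ffact cD n m 0 0.
  rewrite add0n mulrAC mulfV// mul1r => <-.
  by rewrite mulr_suml; apply: eq_bigr => k _; rewrite /p !add0n mulrAC.
rewrite -sumrB (le_trans (ler_norm_sum _ _ _))//.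
apply: (@le_trans _ _ (\sum_(k < n.+1) (m * m)%:R / n%:R * p n k)).
  apply: ler_sum => k _; rewrite -mulrBl normrM (ger0_norm (p_ge0 _ _)).
  by rewrite ler_wpM2r// distrC ffact_ratio_error// -ltnS.
by rewrite -mulr_sumr -/(W n n.+1) W_total mulr1.
Qed.

(* The discrete measures with weight ['C(n, k) c k (n - k)] at [k / n] have
   moments tending to [c m 0]. Their quantile functions [Qn n] are monotone
   with values in [0, 1], so an ultrafilter limit [Q] exists pointwise, and the
   uniform error bound for Riemann sums of monotone functions lets the integrals
   pass to the limit. *)
Lemma hausdorff_moment_problem : exists Q : R -> R,
  [/\ nondecreasing_fun Q, forall u, 0 <= Q u <= 1 &
      forall m, \int[leb]_(u in `[0, 1]) Q u ^+ m = c m 0].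
Proof.
have [G [GU Goo]] := @ultraFilterLemma nat \oo _.
have GP : ProperFilter G by exact: ultra_proper.
have Qlim u : exists q : R, 0 <= q <= 1 /\ (Qn n u @[n --> G] --> q).
  have := @segment_compact R 0 1; rewrite compact_ultra.
  move=> /(_ ((Qn ^~ u) @ G) _).
  have UQ : UltraFilter ((Qn ^~ u) @ G) by exact: ultra_fmap.
  have Q01 : ((Qn ^~ u) @ G) `[0, 1]%classic.
    by apply: (@filterS _ G _ setT) => [n _|]; [rewrite /= in_itv/= Qn01|exact: filterT].
  move=> /(_ UQ Q01)[q [/= q01 Qq]]; exists q; split => //.
pose Q u := sval (cid (Qlim u)).
have QE u : 0 <= Q u <= 1 /\ (Qn n u @[n --> G] --> Q u) by exact: (svalP (cid (Qlim u))).
have Qnd : nondecreasing_fun Q.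
  move=> u v uv; have [_ hu] := QE u; have [_ hv] := QE v.
  rewrite -subr_ge0.
  apply: (@closed_cvg _ _ G _ (fun n => Qn n v - Qn n u) (fun x : R => 0 <= x)).
  - exact: closed_ge.
  - by apply: (@filterS _ G _ setT) => [n _|]; [rewrite subr_ge0 Qn_homo|exact: filterT].
  - exact: cvgB.
exists Q; split=> [//|u|m]; first by have [] := QE u.
apply/eqP; rewrite -subr_eq0 -normr_eq0 eq_le normr_ge0 andbT.
have expnd (f : R -> R) : nondecreasing_fun f -> (forall u, 0 <= f u <= 1) ->
    nondecreasing_fun (fun u => f u ^+ m).
  move=> fnd f01 u v uv; rewrite lerXn2r ?nnegrE ?fnd//.
  + by have /andP[] := f01 u.
  + by have /andP[] := f01 v.
have exp01 (f : R -> R) : (forall u, 0 <= f u <= 1) -> f 1 ^+ m - f 0 ^+ m <= 1.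
  move=> f01; have /andP[a1 a2] := f01 1; have /andP[b1 b2] := f01 0.
  by rewrite lerBlDr (le_trans (exprn_ile1 _ a1 a2))// lerDl exprn_ge0.
pose A (f : R -> R) (K : nat) := \sum_(i < K.+1) f (i%:R / K.+1%:R) ^+ m / K.+1%:R.
(* A Riemann sum involves finitely many values of [Q], so it is the limit along [G] of the sums for
   [Qn n], which stay within the uniform error of an integral tending to [c m 0]. Limit and integral
   are exchanged on finite sums only. *)
have AQ K : `|A Q K - c m 0| <= K.+1%:R^-1.
  apply/ler_addgt0Pr => e e0.
  apply: (@closed_cvg _ _ G _ (fun n => `|A (Qn n) K - c m 0|)
    (fun x : R => x <= K.+1%:R^-1 + e)).
  - exact: closed_le.
  - apply: Goo.
    have [n0 n0P] : exists n0 : nat, (m * m)%:R / e < n0%:R.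
      exists (Num.truncn ((m * m)%:R / e)).+1; exact: truncnS_gt.
    exists (maxn m n0).+1 => //= n /=; rewrite gtn_max => /andP[mn n0n].
    have nn : 0 < n%:R :> R by rewrite ltr0n; lia.
    have -> : A (Qn n) K - c m 0 =
        (\int[leb]_(u in `[0, 1]) Qn n u ^+ m - c m 0) -
        (\int[leb]_(u in `[0, 1]) Qn n u ^+ m - A (Qn n) K) by ring.
    rewrite (le_trans (ler_normB _ _))// addrC lerD//.
      apply: (le_trans (riemann_sum_error K (expnd _ (@Qn_homo n) (Qn01 n)))).
      by rewrite ler_pdivrMr// mulVf// exp01.
    apply: (le_trans (Qn_moment_error (ltnW mn))).
    rewrite ler_pdivrMr// mulrC -ler_pdivrMr//.
    by apply: ltW (lt_trans n0P _); rewrite ltr_nat.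
  - apply: cvg_norm; apply: cvgB; last exact: cvg_cst.
    apply: cvg_big => // [|i _]; first exact: add_continuous.
    apply: cvgM; last exact: cvg_cst.
    apply: (@continuous_cvg _ _ _ _ _ _ (fun x : R => x ^+ m)).
      exact: exprn_continuous.
    by have [] := QE (i%:R / K.+1%:R).
apply/ler_addgt0Pr => e e0; rewrite add0r.
have [K KP] : exists K : nat, 2 / e < K%:R.
  exists (Num.truncn (2 / e)).+1; exact: truncnS_gt.
have -> : \int[leb]_(u in `[0, 1]) Q u ^+ m - c m 0 =
   (\int[leb]_(u in `[0, 1]) Q u ^+ m - A Q K) + (A Q K - c m 0) by ring.
apply: (le_trans (ler_normD _ _)).
have Q01 u : 0 <= Q u <= 1 by have [] := QE u.
have h1 := le_trans (riemann_sum_error K (expnd _ Qnd Q01)) 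
  (ler_wpM2r (_ : 0 <= K.+1%:R^-1) (exp01 _ Q01)).
apply: (le_trans (lerD (h1 _) (AQ K))) => //.
rewrite mul1r -mulr2n -[leLHS]mulr_natl ler_pdivrMr// mulrC -ler_pdivrMr//.
by apply: ltW (lt_trans KP _); rewrite ltr_nat.
Qed.

End HausdorffMomentProblem.

(** * Existence of laws *)

Section OperatorAlgebra.
Context {R : realType} {H : completeNormedModType R[i]}.
Variable dot : {dot H for Num.conj}.
Implicit Types (A B C S T : H -> H) (M : set (H -> H)).

Lemma linear_opD A : linear A -> {morph A : x y / x + y}.
Proof. by move=> lA x y; have := lA 1 x y; rewrite !scale1r. Qed.

Lemma linear_op0 A : linear A -> A 0 = 0.
Proof.
move=> lA; have /eqP := linear_opD lA 0 0.
by rewrite addr0 -subr_eq subrr eq_sym => /eqP.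
Qed.

Lemma linear_opZ A : linear A -> forall a : R[i], {morph A : x / a *: x}.
Proof. by move=> lA a x; have := lA a x 0; rewrite (linear_op0 lA) !addr0. Qed.

Lemma linear_opB A : linear A -> {morph A : x y / x - y}.
Proof.
move=> lA x y; rewrite (linear_opD lA) -scaleN1r (linear_opZ lA).
by rewrite scaleN1r.
Qed.

Lemma commutant_id M : commutant M id.
Proof. by split; [split; [move=> a x y|move=> x]|move=> B _ x]. Qed.

Lemma commutant_comp M A B : commutant M A -> commutant M B -> commutant M (A \o B).
Proof.
move=> [[lA cA] AM] [[lB cB] BM]; split; first split.
- by move=> a x y /=; rewrite lB lA.
- by move=> x; apply: continuous_comp; [exact: cB|exact: cA].
by move=> C MC x /=; rewrite [B (C x)](BM C MC x) [LHS](AM C MC).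
Qed.

Lemma commutant_lin M (a : R[i]) A B : (forall C, M C -> linear C) ->
  commutant M A -> commutant M B -> commutant M (a *: A + B).
Proof.
move=> Ml [[lA cA] AM] [[lB cB] BM]; split; first split.
- move=> b x y; rewrite !fctE/= lA lB !scalerDr !scalerA (mulrC b).
  by rewrite addrACA.
- move=> x; apply: (@continuousD _ _ _ (fun x => a *: A x) B x); last exact: cB.
  by apply: continuousZr; exact: cA.
move=> C MC x; rewrite !fctE/= (Ml C MC) [A (C x)](AM C MC).
by rewrite [B (C x)](BM C MC).
Qed.

Lemma adjoint_comp A A' B B' : adjoint dot A A' -> adjoint dot B B' ->
  adjoint dot (A \o B) (B' \o A').
Proof. by move=> aA aB x y /=; rewrite aA aB. Qed.

Lemma dot_conj (x y : H) : dot x y = (dot y x)^*%R.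
Proof. by rewrite hermC expr0 mul1r. Qed.

Lemma dotZr (a : R) (x y : H) : dot x (a%:C *: y) = a%:C * dot x y.
Proof.
rewrite dot_conj linearZl_LR rmorphM/= -dot_conj.
by congr (_ * _); apply/eqP; rewrite eq_complex/= oppr0 !eqxx.
Qed.

Lemma dotDr (x y z : H) : dot x (y + z) = dot x y + dot x z.
Proof. by rewrite dot_conj linearDl rmorphD/= -!dot_conj. Qed.

Lemma selfadjoint_lin (a : R) A B : selfadjoint dot A -> selfadjoint dot B ->
  selfadjoint dot (a%:C *: A + B).
Proof.
by move=> sA sB x y; rewrite !fctE/= linearDl linearZl_LR/= dotDr dotZr sA sB.
Qed.

Lemma selfadjoint_iter k A : selfadjoint dot A -> selfadjoint dot (iter k A).
Proof. by move=> sA; elim: k => [//|k IH] x y; rewrite iterS sA IH -iterSr. Qed.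

Lemma selfadjoint_comp A B : A \o B =1 B \o A ->
  selfadjoint dot A -> selfadjoint dot B -> selfadjoint dot (A \o B).
Proof.
by move=> AB sA sB x y; rewrite (adjoint_comp sA sB)/= -[B (A y)]/((B \o A) y) -AB.
Qed.

Lemma bounded_operator_norm A : norm_induced_by dot -> bounded_operator A ->
  exists2 K : R, 0 < K & forall x, dot (A x) (A x) <= (K ^+ 2)%:C * dot x x.
Proof.
move=> nd [lA cA].
pose f : {linear H -> H} := HB.pack A (GRing.isLinear.Build _ _ _ _ A lA).
have /linear_boundedP bf : bounded_near f (nbhs 0).
  by apply: continuous_linear_bounded; exact: cA.
have [r [rr rP]] := bf.
(* The norm is complex valued, so the bound [r] is a real element of [R[i]]; a positive number of
   [R] above it is extracted. *)
have Kr : exists2 K : R, 0 < K & r < K%:C.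
  exists (`|complex.Re r| + 1); first by rewrite ltr_pwDr.
  have /complex_realP [r' ->] := rr.
  by rewrite ltcR/= (le_lt_trans (ler_norm _))// ltrDl.
case: Kr => K K0 rK; exists K => // x.
have hx := rP _ rK x; rewrite -!nd rmorphXn/= -exprMn.
by rewrite lerXn2r// nnegrE ?mulr_ge0// lecR ltW.
Qed.

(* Since [T] and [S] commute, even powers move to the other side of the inner
   product; the exponents [(1, 1)] reduce to [(2, 1)] and [(1, 2)] by
   [x = T x + S x]. *)
Lemma mixed_power_ge0 T S : selfadjoint dot T -> selfadjoint dot S ->
  linear T -> (forall x, S x = x - T x) ->
  (forall x, 0 <= dot (T x) x) -> (forall x, 0 <= dot (S x) x) ->
  forall k j x, 0 <= dot (iter k T (iter j S x)) x.
Proof.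
move=> sT sS lT SE T0 S0.
have TB x y : T (x - y) = T x - T y.
  by rewrite linear_opD// -scaleN1r linear_opZ// scaleN1r.
have lS : linear S.
  by move=> a x y; rewrite !SE lT scalerBr opprD addrACA.
have TS x : T (S x) = S (T x) by rewrite !SE TB.
have TSn j x : T (iter j S x) = iter j S (T x).
  by elim: j => [//|j IH]; rewrite iterS TS IH -iterS.
have STn k x : S (iter k T x) = iter k T (S x).
  by elim: k => [//|k IH]; rewrite iterS -TS IH -iterS.
pose P k j := forall x, 0 <= dot (iter k T (iter j S x)) x.
have Pk k j : P k j -> P k.+2 j.
  move=> Pkj x; rewrite iterS sT iterS -[T (iter k T _)]/(iter k.+1 T _) iterSr TSn.
  exact: Pkj.
have Pj k j : P k j -> P k j.+2.
  move=> Pkj x; rewrite iterS -STn sS iterSr; exact: Pkj.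
have P11 : P 1%N 1%N.
  move=> x; have -> : iter 1 T (iter 1 S x) = iter 2 T (iter 1 S x) + iter 1 T (iter 2 S x).
    have iS : iter 1 S x = T (iter 1 S x) + iter 2 S x by rewrite /= (SE (S x)) addrC subrK.
    by rewrite {1}iS linear_opD.
  by rewrite linearDl addr_ge0//; [exact: (Pk 0%N 1%N)|exact: (Pj 1%N 0%N)].
have Podd k j : P (odd k) (odd j).
  case: (odd k); case: (odd j); [exact: P11|exact: T0|exact: S0|].
  by move=> x; exact: dnorm_ge0.
have Podd2 k j : P k (odd j).
  have [n] := ubnP k; elim: n k => // n IH [|[|k]] kn.
  - exact: (Podd 0%N).
  - exact: (Podd 1%N).
  - by apply: Pk; apply: IH; rewrite -ltnS ltnW.
move=> k j; have [n] := ubnP j; elim: n j => // n IH [|[|j]] jn.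
- exact: (Podd2 k 0%N).
- exact: (Podd2 k 1%N).
- by apply: Pj; apply: IH; rewrite -ltnS ltnW.
Qed.

End OperatorAlgebra.

Section UniformMoments.
Context {R : realType}.
Notation P := (uniform_prob (@ltr01 R)).

Lemma integral_uniform01 (f : R -> \bar R) : measurable_fun setT f ->
  (\int[P]_x f x = \int[lebesgue_measure]_(x in `[0%R, 1%R]) f x)%E.
Proof.
move=> mf; rewrite integralE [RHS]integralE !integral_uniform//.
- by rewrite subr0 invr1 !mul1e.
- exact: measurable_funeneg.
- exact: measurable_funepos.
Qed.

Lemma bounded_integrable_probability d (T : measurableType d)
    (mu : probability T R) (f : T -> R) (r : R) :
  measurable_fun setT f -> (forall x, `|f x| <= r) ->
  mu.-integrable setT (EFin \o f).
Proof.
move=> mf fr; apply: measurable_bounded_integrable => //.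
  by rewrite /= probability_setT ltry.
by exists r; split; [exact: num_real|move=> s rs x _; exact: le_trans (fr x) (ltW rs)].
Qed.

Lemma exists_distribution_moments (X : R -> R) (r : R) :
  measurable_fun setT X -> (forall x, `|X x| <= r) ->
  exists mu : probability (measurableTypeR R) R, forall k : nat,
    mu.-integrable setT (fun x : measurableTypeR R => (x ^+ k)%:E) /\
    \int[mu]_x x ^+ k = \int[P]_u X u ^+ k.
Proof.
move=> mX Xr.
have mX' : @measurable_fun _ _ (measurableTypeR R) (measurableTypeR R) setT X by exact: mX.
pose Xm : {mfun measurableTypeR R >-> measurableTypeR R} :=
  HB.pack X (isMeasurableFun.Build _ _ (measurableTypeR R) (measurableTypeR R) X mX').
exists (distribution P Xm) => k.
have mk : measurable_fun setT (fun x : measurableTypeR R => (x ^+ k)%:E).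
  by apply/measurable_EFinP; exact: exprn_measurable.
have ik : P.-integrable setT ((fun x : measurableTypeR R => (x ^+ k)%:E) \o Xm).
  apply: (@bounded_integrable_probability _ _ P (fun u => X u ^+ k) (r ^+ k)).
    exact: measurable_funX.
  by move=> x; rewrite normrX lerXn2r// nnegrE (le_trans _ (Xr x)).
split.
  exact: (integrable_pushforward mX' mk).
by rewrite /Rintegral integral_distribution.
Qed.

End UniformMoments.

Section NCProbability.
Context {R : realType} {H : completeNormedModType R[i]}.
Variables (dot : {dot H for Num.conj}) (M : set (H -> H)) (tau : (H -> H) -> R[i]).
Hypothesis Mtau : nc_probability_space dot M tau.
Implicit Types (A B C S T : H -> H).

Let Mcc : commutant (commutant M) = M. Proof. by case: Mtau => _ []. Qed.

Lemma nc_bounded A : M A -> bounded_operator A.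
Proof. by rewrite -Mcc => -[]. Qed.

Lemma nc_linear A : M A -> linear A.
Proof. by case/nc_bounded. Qed.

Lemma nc_id : M id. Proof. by rewrite -Mcc; exact: commutant_id. Qed.

Lemma nc_comp A B : M A -> M B -> M (A \o B).
Proof. by rewrite -Mcc => MA MB; exact: commutant_comp. Qed.

Lemma nc_lin (a : R[i]) A B : M A -> M B -> M (a *: A + B).
Proof.
by rewrite -Mcc => MA MB; apply: commutant_lin => // C [[]].
Qed.

Lemma nc_iter k A : M A -> M (iter k A).
Proof.
move=> MA; elim: k => [|k IH]; first exact: nc_id.
exact: nc_comp.
Qed.

Lemma nc0 : M 0.
Proof. by rewrite -(addNr id) -scaleN1r; apply: nc_lin; exact: nc_id. Qed.

Lemma tau_lin (a : R[i]) A B : M A -> M B -> tau (a *: A + B) = a * tau A + tau B.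
Proof. by case: Mtau => _ _ [h _ _] _ _; exact: h. Qed.

Lemma tau_id : tau id = 1. Proof. by case: Mtau => _ _ [_ _ h] _ _. Qed.

Lemma tauD A B : M A -> M B -> tau (A + B) = tau A + tau B.
Proof. by move=> MA MB; rewrite -[A in LHS]scale1r tau_lin// mul1r. Qed.

Lemma tau0 : tau 0 = 0.
Proof. by have := tauD nc0 nc0; rewrite addr0 => /eqP; rewrite -subr_eq subrr eq_sym => /eqP. Qed.

Lemma tauZ (a : R[i]) A : M A -> tau (a *: A) = a * tau A.
Proof. by move=> MA; rewrite -[a *: A]addr0 tau_lin ?tau0 ?addr0//; exact: nc0. Qed.

(* Normality applied to the directed set [{A, S}], whose supremum is [S]. *)
Lemma tau_le A S : M A -> selfadjoint dot A -> M S -> selfadjoint dot S ->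
  op_le dot A S -> tau A <= tau S.
Proof.
move=> MA sA MS sS AS.
have [_ _ _ nrm _] := Mtau.
have SS : op_le dot S S by move=> x.
have [ub _] : supremums [set tau B | B in [set A; S]] (tau S).
  apply: nrm.
  - by exists A; left.
  - by move=> B [->|->].
  - by move=> B C [->|->] [->|->]; exists S; split => //; right.
  - by split=> [//|B [->|->]//|T sT ubT]; apply: ubT; right.
by apply: ub; exists A => //; left.
Qed.

(** Positivity in [state] concerns products of an operator with its adjoint, and writing [A] as one
    would take a square root. Monotonicity, drawn from normality, gives the claim by comparison with
    0. *)
Lemma tau_ge0 A : M A -> selfadjoint dot A -> (forall x, 0 <= dot (A x) x) -> 0 <= tau A.
Proof.
move=> MA sA A0; rewrite -tau0; apply: tau_le => //; first exact: nc0.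
  by move=> x y; rewrite [LHS]linear0l dot_conj [dot 0 x]linear0l rmorph0.
by move=> x; rewrite [leLHS]linear0l.
Qed.

Lemma exists_law A : M A -> selfadjoint dot A ->
  exists mu : probability (measurableTypeR R) R, is_law tau A mu.
Proof.
move=> MA sA.
have [nd _ _ _ _] := Mtau.
have [K K0 AK] := bounded_operator_norm nd (nc_bounded MA).
have lA := nc_linear MA.
(* As [A] is bounded by [K], the factor 1 / (2 K) places T = a A + 1/2 between 0 and 1, with S = 1 -
   T. *)
pose a := (2 * K)^-1; pose T : H -> H := a%:C *: A + 2^-1%:C *: id.
pose S : H -> H := (- a)%:C *: A + 2^-1%:C *: id.
have sid : selfadjoint dot (2^-1%:C *: id).
  move=> x y; rewrite !fctE/= linearZl_LR dotZr//.
have Mid : M (2^-1%:C *: id) by rewrite -[_ *: id]addr0; apply: nc_lin; [exact: nc_id|exact: nc0].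
have sT : selfadjoint dot T by exact: selfadjoint_lin.
have sS : selfadjoint dot S by exact: selfadjoint_lin.
have MT : M T by exact: nc_lin.
have MS : M S by exact: nc_lin.
have SE x : S x = x - T x.
  rewrite /S /T !fctE/= rmorphN/= scaleNr opprD addrA [x - _]addrC -addrA; congr (_ + _).
  rewrite -{2}[x]scale1r -scalerBl; congr (_ *: _).
  by apply/eqP; rewrite eq_complex/= subr0 eqxx andbT; apply/eqP; field.
have a0 : 0 < a by rewrite invr_gt0 mulr_gt0.
(* The signs 1 and -1 give [T] and [S]. Expanding the squared norm of (A + e K) x and bounding that
   of A x by K^2 times that of x leaves 4 K^2 times the quadratic form. *)
have signed_ge0 (e : R) x : e ^+ 2 = 1 ->
    0 <= dot (((e * a)%:C *: A + 2^-1%:C *: id) x) x.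
  move=> e2.
  have h : 0 <= dot (A x + (e * K)%:C *: x) (A x + (e * K)%:C *: x) by exact: dnorm_ge0.
  rewrite linearDl/= !dotDr !linearZl_LR/= !dotZr -[dot x (A x)]sA in h.
  have h2 := le_trans h (lerD (lerD (AK x) (lexx _)) (lexx _)).
  rewrite !fctE/= linearDl !linearZl_LR/=.
  have K0C : K%:C != 0 :> R[i] by rewrite eq_complex/= eqxx andbT gt_eqF.
  have e2C : e%:C ^+ 2 = 1 :> R[i] by rewrite -rmorphXn/= e2.
  have -> : (e * a)%:C * dot (A x) x + 2^-1%:C * dot x x = ((2 * K) ^-2)%:C *
    ((K ^+ 2)%:C * dot x x + (e * K)%:C * dot (A x) x +
     ((e * K)%:C * dot (A x) x + (e * K)%:C * ((e * K)%:C * dot x x))).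
    have -> : (e * K)%:C * ((e * K)%:C * dot x x) = (K ^+ 2)%:C * dot x x.
      by rewrite mulrA -rmorphM/= mulrACA -!expr2 e2 mul1r.
    rewrite /a !(rmorphM, fmorphV, rmorphXn, rmorph_nat)/=.
    by field.
  by rewrite mulr_ge0// lecR invr_ge0 exprn_ge0// mulr_ge0// ltW.
have T0 x : 0 <= dot (T x) x.
  by have := signed_ge0 1 x (expr1n _ _); rewrite mul1r.
have S0 x : 0 <= dot (S x) x.
  by have := signed_ge0 (-1) x; rewrite sqrrN expr1n mulN1r => /(_ erefl).
have TS : T \o S =1 S \o T.
  move=> x /=; rewrite !SE linear_opD; last exact: nc_linear.
  by rewrite -scaleN1r (linear_opZ (nc_linear MT)) scaleN1r.
have TSn k j : iter k T \o iter j S =1 iter j S \o iter k T.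
  have TSj y : T (iter j S y) = iter j S (T y).
    by elim: j => [//|j IHj]; rewrite iterS [LHS]TS/= IHj.
  by move=> x /=; elim: k => [//|k IH]; rewrite iterS IH TSj.
pose c k j := complex.Re (tau (iter k T \o iter j S)).
have Mkj k j : M (iter k T \o iter j S) by apply: nc_comp; exact: nc_iter.
have cE k j : tau (iter k T \o iter j S) = (c k j)%:C /\ 0 <= c k j.
  have h : 0 <= tau (iter k T \o iter j S).
    apply: tau_ge0 => //.
      by apply: selfadjoint_comp => //; exact: selfadjoint_iter.
    by move=> x; apply: mixed_power_ge0 => //; exact: nc_linear.
  split; last by move: h; rewrite lecE => /andP[].
  by apply/eqP; rewrite eq_complex/= eqxx/= (ger0_Im h).
have cD k j : c k j = c k.+1 j + c k j.+1.
  rewrite /c -raddfD -tauD//; congr (complex.Re (tau _)); apply/funext => x.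
  transitivity (iter k.+1 T (iter j S x) + iter k T (iter j.+1 S x)); last by [].
  rewrite iterSr -(linear_opD (nc_linear (nc_iter k MT))).
  by rewrite iterS (SE (iter j S x)) addrC subrK.
have c00 : c 0%N 0%N = 1 by rewrite /c [_ \o _](_ : _ = id)// tau_id.
have [Q [Qnd Q01 QE]] := hausdorff_moment_problem (fun k j => (cE k j).2) cD c00.
pose P := uniform_prob (@ltr01 R).
pose X (u : R) := 2 * K * Q u - K.
have mQ : measurable_fun setT Q by exact: nondecreasing_measurable.
have mX : measurable_fun setT X.
  by apply: measurable_funB => //; apply: measurable_funM.
have Xr u : `|X u| <= K.
  have /andP[Q0 Q1] := Q01 u; rewrite ler_norml /X; apply/andP; split.
    by rewrite lerBrDl subrr !mulr_ge0// ltW.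
  by rewrite lerBlDr -mulr2n -[leRHS]mulr_natl ler_piMr// mulr_ge0// ltW.
have [mu muP] := exists_distribution_moments mX Xr.
exists mu => k; have [muk ->] := muP k; split=> //.
have intQX i j : P.-integrable setT (EFin \o (fun u => Q u ^+ i * X u ^+ j)).
  apply: (@bounded_integrable_probability _ _ _ P _ (K ^+ j)).
    by apply: measurable_funM; exact: measurable_funX.
  move=> u; rewrite normrM !normrX.
  have /andP[Q0 Q1] := Q01 u.
  rewrite -[leRHS]mul1r ler_pM ?exprn_ge0//.
    by rewrite exprn_ile1// ger0_norm.
  by rewrite lerXn2r// nnegrE// ltW.
have AE x : A x = (2 * K)%:C *: T x + (- K)%:C *: x.
  rewrite /T !fctE/= scalerDr !scalerA -!rmorphM/= /a mulfV ?gt_eqF ?mulr_gt0//.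
  rewrite scale1r -addrA -scalerDl -rmorphD/= [X in X%:C](_ : _ = 0) ?scale0r ?addr0//.
  by field.
(* Moments are known for powers of [T] only; A = 2 K T - K trades one [A] for one [T] in the
   induction on [j]. *)
suff mom j i : tau (iter i T \o iter j A) = (\int[P]_u (Q u ^+ i * X u ^+ j))%:C.
  have := mom k 0%N; rewrite [_ \o _](_ : _ = iter k A)// => ->.
  by congr (_%:C); apply: eq_Rintegral => u _; rewrite expr0 mul1r.
elim: j i => [|j IH] i.
  have [e _] := cE i 0%N; rewrite [_ \o _](_ : _ = iter i T \o iter 0 S)// e -QE.
  congr (_%:C); rewrite /Rintegral integral_uniform01.
    by congr fine; apply: eq_integral => u _; rewrite expr0 mulr1.
  by case/integrableP: (intQX i 0%N).
have MTA n l : M (iter n T \o iter l A) by apply: nc_comp; exact: nc_iter.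
have -> : iter i T \o iter j.+1 A =
    (2 * K)%:C *: (iter i.+1 T \o iter j A) + (- K)%:C *: (iter i T \o iter j A).
  apply/funext => x.
  transitivity ((2 * K)%:C *: iter i.+1 T (iter j A x) + (- K)%:C *: iter i T (iter j A x)); last by [].
  have lT := nc_linear (nc_iter i MT).
  by rewrite iterSr -!(linear_opZ lT) -(linear_opD lT) -AE.
have M2 : M ((- K)%:C *: (iter i T \o iter j A)).
  by rewrite -[X in M X]addr0; apply: nc_lin => //; exact: nc0.
rewrite tau_lin// tauZ// !IH -!rmorphM -rmorphD/=; congr (_%:C).
rewrite -!RintegralZl// -RintegralD//.
- by apply: eq_Rintegral => u _; rewrite /X !exprS; ring.
- by rewrite (_ : _ \o _ = fun u => ((2 * K)%:E * (EFin \o (fun u => Q u ^+ i.+1 * X u ^+ j)%R) u)%E)//; exact: integrableZl.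
- by rewrite (_ : _ \o _ = fun u => ((- K)%:E * (EFin \o (fun u => Q u ^+ i * X u ^+ j)%R) u)%E)//; exact: integrableZl.
Qed.

Lemma lawP A : M A -> selfadjoint dot A -> is_law tau A (law tau A).
Proof. by move=> MA sA; apply: getPex; exact: exists_law. Qed.

Lemma law_moment A : M A -> selfadjoint dot A -> forall k,
  tau (iter k A) = (\int[law tau A]_x x ^+ k)%:C.
Proof. by move=> MA sA k; have [] := lawP MA sA k. Qed.

(** The scalar K^(2 k) dominates A^(2 k) in the Loewner order and [tau] is monotone. This geometric
    growth later confines the law to a bounded interval. *)
Lemma law_even_moment_le A : M A -> selfadjoint dot A ->
  exists2 K : R, 0 < K &
    forall k, \int[law tau A]_x x ^+ (k + k) <= (K ^+ 2) ^+ k.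
Proof.
move=> MA sA.
have [nd _ _ _ _] := Mtau.
have [K K0 AK] := bounded_operator_norm nd (nc_bounded MA).
exists K => // k.
have AKk x : dot (iter k A x) (iter k A x) <= ((K ^+ 2) ^+ k)%:C * dot x x.
  elim: k x => [|k IH] x; first by rewrite expr0 mul1r.
  rewrite iterSr (le_trans (IH _))// (exprSr (K ^+ 2) k) rmorphM/= -mulrA ler_wpM2l//.
  by rewrite lecR exprn_ge0// exprn_ge0// ltW.
rewrite -lecR -law_moment// -[X in _ <= X]mulr1 -tau_id -tauZ; last exact: nc_id.
apply: tau_le.
- exact: nc_iter.
- exact: selfadjoint_iter.
- by rewrite -[X in M X]addr0; apply: nc_lin; [exact: nc_id|exact: nc0].
- by move=> x y; rewrite !fctE/= linearZl_LR dotZr.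
- move=> x; rewrite iterD (selfadjoint_iter k sA).
  by rewrite !fctE/= linearZl_LR/=.
Qed.

End NCProbability.

(** * Boolean independence and rank one perturbation *)

Section BooleanWords.
Context {R : realType} {H : completeNormedModType R[i]}.
Variables (dot : {dot H for Num.conj}) (M : set (H -> H)) (tau : (H -> H) -> R[i]).
Hypothesis Mtau : nc_probability_space dot M tau.
Variables (X B : H -> H).
Hypotheses (MX : M X) (MB : M B) (indep : boolean_independent tau X B).

(** Indexing letters by booleans makes the exchange of roles in an alternating word a negation. *)
Let Z (b : bool) : H -> H := if b then X else B.

Let MZ b : M (Z b). Proof. by case: b. Qed.

Definition bool_word (w : seq bool) : H -> H := foldr (fun b f => Z b \o f) id w.

Lemma alternating_word_rcons (c : bool) (ks : seq nat) (k : nat) :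
  alternating_word (Z c) (Z (~~ c)) (rcons ks k) =
  alternating_word (Z c) (Z (~~ c)) ks \o iter k (Z (c (+) odd (size ks))).
Proof.
elim: ks c => [|j ks IH] c /=; first by rewrite addbF.
by have := IH (~~ c); rewrite negbK addbN addNb => ->.
Qed.

Lemma alternating_moments_rcons (c : bool) (ks : seq nat) (k : nat) :
  alternating_moments tau (Z c) (Z (~~ c)) (rcons ks k) =
  alternating_moments tau (Z c) (Z (~~ c)) ks * tau (iter k (Z (c (+) odd (size ks)))).
Proof.
elim: ks c => [|j ks IH] c /=; first by rewrite addbF mulrC.
by have := IH (~~ c); rewrite negbK addbN addNb => ->; rewrite mulrA.
Qed.

(* Alternating words that the next block of letters [Z l] keeps alternating. *)
Definition alternates_with (l : bool) (g : H -> H) : Prop :=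
  exists c ks, [/\ all (leq 1) ks, g = alternating_word (Z c) (Z (~~ c)) ks
    & c (+) odd (size ks) = l].

Lemma alternates_with_block l g k : alternates_with l g ->
  alternates_with (~~ l) (g \o iter k.+1 (Z l)).
Proof.
move=> [c [ks [ks1 -> <-]]]; exists c, (rcons ks k.+1); split.
- by rewrite all_rcons.
- by rewrite alternating_word_rcons.
- by rewrite size_rcons/= addbN.
Qed.

Lemma tau_alternating c ks : all (leq 1) ks ->
  tau (alternating_word (Z c) (Z (~~ c)) ks) = alternating_moments tau (Z c) (Z (~~ c)) ks.
Proof. by move=> /indep[]; case: c. Qed.

(** Independence speaks of exponents at least 1; for the exponent 0 the block is the identity, of
    state 1. *)
Lemma tau_block l g k : alternates_with l g ->
  tau (g \o iter k (Z l)) = tau g * tau (iter k (Z l)).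
Proof.
move=> [c [ks [ks1 -> <-]]]; case: k => [|k]; first by rewrite (tau_id Mtau) mulr1.
rewrite -alternating_word_rcons !tau_alternating ?all_rcons//.
by rewrite alternating_moments_rcons.
Qed.

Lemma bool_word_rcons w b : bool_word (rcons w b) = bool_word w \o Z b.
Proof. by elim: w => [//|a w IH]; rewrite /= IH. Qed.

(** The trailing block of [Z l] is taken maximal, hence empty when the word ends in the other
    letter, so that the prefix alternates up to it. *)
Lemma bool_word_block w l : exists g k, bool_word w = g \o iter k (Z l) /\ alternates_with l g.
Proof.
elim/last_ind: w l => [|w b IH] l.
  by exists id, 0%N; split => //; exists l, [::]; rewrite /= addbF.
have [g [k [wE gb]]] := IH b; rewrite bool_word_rcons wE.
have iE : iter k (Z b) \o Z b = iter k.+1 (Z b) by apply/funext => x; rewrite iterSr.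
have [<-|bl] := eqVneq b l; first by exists g, k.+1; rewrite -compA iE.
exists (g \o iter k.+1 (Z b)), 0%N; rewrite -compA iE; split=> //.
by have -> : l = ~~ b; [case: b l bl {wE gb iE} => -[]|exact: alternates_with_block].
Qed.

Lemma bool_word_alternates w b : alternates_with (~~ b) (bool_word (rcons w b)).
Proof.
have [g [k [wE gb]]] := bool_word_block w b; rewrite bool_word_rcons wE.
have iE : iter k (Z b) \o Z b = iter k.+1 (Z b) by apply/funext => x; rewrite iterSr.
by rewrite -compA iE; exact: alternates_with_block.
Qed.

Hypothesis tauB_even : forall k, tau (iter k.+2 B) = tau (iter k B).
Hypothesis tauB : tau B = 0.

(** Each condition is linear in [f], which lets it pass from words to polynomials. *)
Definition boolean_factorization (f : H -> H) : Prop :=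
  [/\ forall m, tau (f \o B \o iter m X) = tau (f \o B) * tau (iter m X),
      tau (f \o X \o B) = 0 &
      tau (f \o B \o B) = tau f].

Lemma bool_word_factorization w : boolean_factorization (bool_word w).
Proof.
split.
- by move=> m; have := tau_block m (bool_word_alternates w false); rewrite bool_word_rcons.
- have := tau_block 1 (bool_word_alternates w true); rewrite bool_word_rcons /= => ->.
  by rewrite [X in _ * tau X](_ : _ = B)// tauB mulr0.
- have [g [k [-> gl]]] := bool_word_block w false.
  have -> : (g \o iter k (Z false)) \o B \o B = g \o iter k.+2 (Z false).
    by apply/funext => x; rewrite /= -!iterS !iterSr.
  by rewrite !tau_block// tauB_even.
Qed.

(** Powers of N - (X + r B)^2 are combinations of words, not words. Letters enter on the right, the
    side where the factorization acts. *)
Inductive nc_polynomial : (H -> H) -> Prop :=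
| nc_polynomial_id : nc_polynomial id
| nc_polynomial_letter f b : nc_polynomial f -> nc_polynomial (f \o Z b)
| nc_polynomial_lin a f g : nc_polynomial f -> nc_polynomial g ->
    nc_polynomial (a *: f + g).

Lemma nc_polynomial_mem f : nc_polynomial f -> M f.
Proof.
elim=> [|{}f b _ Mf|a {}f g _ Mf _ Mg]; first exact: (nc_id Mtau).
- exact: (nc_comp Mtau).
- exact: (nc_lin Mtau).
Qed.

Lemma bool_word_mem w : M (bool_word w).
Proof. by elim: w => [|b w IH]; [exact: (nc_id Mtau)|exact: (nc_comp Mtau)]. Qed.

Lemma nc_polynomial_factorization f : nc_polynomial f -> boolean_factorization f.
Proof.
(* A letter at the right end of [f] is absorbed into the word that follows, hence the generalization
   over [w]. *)
suff h : nc_polynomial f -> forall w, boolean_factorization (f \o bool_word w).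
  by move=> pf; exact: (h pf [::]).
elim=> [w|{}f b _ IH w|a {}f g pf IHf pg IHg w]; first exact: bool_word_factorization.
  exact: (IH (b :: w)).
have [f1 f2 f3] := IHf w; have [g1 g2 g3] := IHg w.
have Mf := nc_comp Mtau (nc_polynomial_mem pf) (bool_word_mem w).
have Mg := nc_comp Mtau (nc_polynomial_mem pg) (bool_word_mem w).
have E h : (a *: f + g) \o bool_word w \o h =
  a *: (f \o bool_word w \o h) + (g \o bool_word w \o h) by [].
have tE h : M h -> tau ((a *: f + g) \o bool_word w \o h) =
    a * tau (f \o bool_word w \o h) + tau (g \o bool_word w \o h).
  by move=> Mh; rewrite E (tau_lin Mtau)//; exact: (nc_comp Mtau).
have MBX m : M (B \o iter m X) by apply: (nc_comp Mtau) => //; exact: (nc_iter Mtau).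
have MXB : M (X \o B) by exact: (nc_comp Mtau).
have MBB : M (B \o B) by exact: (nc_comp Mtau).
pose F := (a *: f + g) \o bool_word w.
pose f' := f \o bool_word w; pose g' := g \o bool_word w.
rewrite -/F; split.
- move=> m; have -> : tau (F \o B \o iter m X) =
    a * tau (f' \o B \o iter m X) + tau (g' \o B \o iter m X) := tE _ (MBX m).
  by rewrite (tE _ MB) f1 g1 mulrDl mulrA.
- have -> : tau (F \o X \o B) =
    a * tau (f' \o X \o B) + tau (g' \o X \o B) := tE _ MXB.
  by rewrite f2 g2 mulr0 addr0.
- have -> : tau (F \o B \o B) =
    a * tau (f' \o B \o B) + tau (g' \o B \o B) := tE _ MBB.
  by rewrite f3 g3 [RHS](tE _ (nc_id Mtau)).
Qed.

End BooleanWords.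

(** As l + Y^2 = (l + N) - (N - Y^2), the powers of N - Y^2 are the coefficients of the resolvent in
    powers of (l + N)^-1. *)
Definition square_defect {R : realType} {H : completeNormedModType R[i]} (N : R) (Y : H -> H)
  : H -> H := fun x => N%:C *: x - Y (Y x).

Section RankOnePerturbation.
Context {R : realType} {H : completeNormedModType R[i]}.
Variables (dot : {dot H for Num.conj}) (M : set (H -> H)) (tau : (H -> H) -> R[i]).
Hypothesis Mtau : nc_probability_space dot M tau.
Implicit Types (f Y : H -> H).

Lemma square_defectE N Y f : linear f ->
  f \o square_defect N Y = N%:C *: f + (-1) *: (f \o Y \o Y).
Proof.
move=> lf; apply/funext => x; rewrite /square_defect !fctE/= scaleN1r.
by rewrite (linear_opB lf) (linear_opZ lf).
Qed.

Lemma square_defect_mem N Y : M Y -> M (square_defect N Y).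
Proof.
move=> MY; have := @square_defectE N Y id _.
rewrite [id \o _](_ : _ = square_defect N Y)// => -> //.
apply: (nc_lin Mtau); first exact: (nc_id Mtau).
rewrite -[X in M X]addr0; apply: (nc_lin Mtau); last exact: (nc0 Mtau).
exact: (nc_comp Mtau).
Qed.

Lemma tau_square_defect N Y f : M f -> M Y ->
  tau (f \o square_defect N Y) = N%:C * tau f - tau (f \o Y \o Y).
Proof.
move=> Mf MY; have MfYY : M (f \o Y \o Y) by do 2 apply: (nc_comp Mtau) => //.
rewrite square_defectE; last exact: (nc_linear Mtau).
rewrite (tau_lin Mtau)//; last first.
  by rewrite -[X in M X]addr0; apply: (nc_lin Mtau) => //; exact: (nc0 Mtau).
by rewrite (tauZ Mtau)// mulN1r.
Qed.

Lemma iter_square_defectC j N Y x : linear Y ->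
  iter j (square_defect N Y) (Y x) = Y (iter j (square_defect N Y) x).
Proof.
move=> lY; have YS z : square_defect N Y (Y z) = Y (square_defect N Y z).
  by rewrite /square_defect (linear_opB lY) (linear_opZ lY).
by elim: j => [//|j IH]; rewrite !iterS IH YS.
Qed.

Lemma iter_square_defect_sqr (g : H -> H) m j N Y : linear Y ->
  (g \o iter m Y \o iter j (square_defect N Y)) \o Y \o Y =
  g \o iter m.+2 Y \o iter j (square_defect N Y).
Proof.
by move=> lY; apply/funext => x; rewrite [LHS]/= !iter_square_defectC// -!iterSr.
Qed.

Lemma iter_square_defectSr (g : H -> H) j N Y :
  g \o iter j.+1 (square_defect N Y) = (g \o iter j (square_defect N Y)) \o square_defect N Y.
Proof. by apply/funext => x; rewrite [LHS]/= -iterS iterSr. Qed.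

(** The factor x^m serves the induction on [j]: removing one defect costs two more powers of [Y]. *)
Lemma law_square_defect_moment Y N (m j : nat) : M Y -> selfadjoint dot Y ->
  (law tau Y).-integrable setT (EFin \o (fun x => x ^+ m * (N - x ^+ 2) ^+ j)) /\
  tau (iter m Y \o iter j (square_defect N Y)) =
    (\int[law tau Y]_x (x ^+ m * (N - x ^+ 2) ^+ j))%:C.
Proof.
move=> MY sY; elim: j m => [|j IH] m.
  have [imu tE] := lawP Mtau MY sY m.
  have e : (fun x : R => x ^+ m * (N - x ^+ 2) ^+ 0) = (fun x => x ^+ m).
    by apply/funext => x; rewrite expr0 mulr1.
  by rewrite e.
have [i1 e1] := IH m; have [i2 e2] := IH m.+2.
have e : (fun x : R => x ^+ m * (N - x ^+ 2) ^+ j.+1) =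
    (fun x => N * (x ^+ m * (N - x ^+ 2) ^+ j) - x ^+ m.+2 * (N - x ^+ 2) ^+ j).
  by apply/funext => x; rewrite !exprS; ring.
have i1N : (law tau Y).-integrable setT (EFin \o (fun x => N * (x ^+ m * (N - x ^+ 2) ^+ j))).
  rewrite (_ : _ \o _ = fun x => (N%:E * (EFin \o (fun x => x ^+ m * (N - x ^+ 2) ^+ j)%R) x)%E)//.
  exact: integrableZl.
rewrite e; split.
  rewrite (_ : _ \o _ = (fun x => (EFin \o (fun x => N * (x ^+ m * (N - x ^+ 2) ^+ j))%R) x -
     (EFin \o (fun x => x ^+ m.+2 * (N - x ^+ 2) ^+ j)%R) x)%E)//.
  exact: integrableB.
rewrite RintegralB// RintegralZl// rmorphB rmorphM/= -e1 -e2.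
have lY := nc_linear Mtau MY.
have Mf : M (iter m Y \o iter j (square_defect N Y)).
  by apply: (nc_comp Mtau); apply: (nc_iter Mtau) => //; exact: square_defect_mem.
rewrite iter_square_defectSr tau_square_defect//; congr (_ - tau _).
exact: (iter_square_defect_sqr id m j N lY).
Qed.

Variables (X B : H -> H) (r : R).
Hypotheses (MX : M X) (MB : M B) (indep : boolean_independent tau X B).
Hypothesis tauB_even : forall k, tau (iter k.+2 B) = tau (iter k B).
Hypothesis tauB : tau B = 0.
Hypothesis tauX_odd : forall k, odd k -> tau (iter k X) = 0.
Variable N : R.

Let Y : H -> H := X + r%:C *: B.
Let A := square_defect N Y.
Let C := square_defect N X.

Let YE f : linear f -> f \o Y = r%:C *: (f \o B) + (f \o X).
Proof.
move=> lf; apply/funext => x; transitivity (f (X x + r%:C *: B x)); first by [].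
by rewrite (linear_opD lf) (linear_opZ lf) addrC.
Qed.

Let MY : M Y. Proof. by rewrite /Y addrC; exact: (nc_lin Mtau). Qed.

Let poly_letter f (b : bool) : nc_polynomial X B f -> nc_polynomial X B (f \o if b then X else B).
Proof. exact: nc_polynomial_letter. Qed.

Let poly_linear f : nc_polynomial X B f -> linear f.
Proof. by move=> /(nc_polynomial_mem Mtau MX MB)/(nc_linear Mtau). Qed.

Let poly_Y f : nc_polynomial X B f -> nc_polynomial X B (f \o Y).
Proof.
move=> pf; rewrite YE; last exact: poly_linear.
by apply: nc_polynomial_lin; [exact: (poly_letter false)|exact: (poly_letter true)].
Qed.

Let poly_A f : nc_polynomial X B f -> nc_polynomial X B (f \o A).
Proof.
move=> pf; rewrite /A square_defectE; last exact: poly_linear.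
rewrite addrC; apply: nc_polynomial_lin; first by do 2 apply: poly_Y.
rewrite -[N%:C *: f](subrK f) -[X in _ - X]scale1r -scalerBl.
exact: nc_polynomial_lin.
Qed.

Let poly_Ak k : nc_polynomial X B (iter k A).
Proof.
elim: k => [|k IH]; first exact: nc_polynomial_id.
have -> : iter k.+1 A = iter k A \o A by apply/funext => x; rewrite iterSr.
exact: poly_A.
Qed.

Let MC : M C. Proof. exact: square_defect_mem. Qed.

(** [C] is a polynomial in [X], and the factorization after a final [B] is linear in what follows;
    the power [m] absorbs the X^2 released at each step. *)
Let factor_C f i m : nc_polynomial X B f ->
  tau (f \o B \o iter m X \o iter i C) = tau (f \o B) * tau (iter m X \o iter i C).
Proof.
move=> pf; have [f1 _ _] := nc_polynomial_factorization Mtau MX MB indep tauB_even tauB pf.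
have MfB : M (f \o B) by apply: (nc_comp Mtau) => //; exact: (nc_polynomial_mem Mtau MX MB).
elim: i m => [|i IH] m; first exact: f1.
have MXC n : M (iter n X \o iter i C) by apply: (nc_comp Mtau); exact: (nc_iter Mtau).
have lX := nc_linear Mtau MX.
rewrite (iter_square_defectSr _ i) tau_square_defect//; last exact: (nc_comp Mtau MfB (MXC m)).
rewrite (iter_square_defectSr _ i) tau_square_defect// IH.
rewrite iter_square_defect_sqr// IH (iter_square_defect_sqr id)//.
by ring.
Qed.

Let odd_C i m : odd m -> tau (iter m X \o iter i C) = 0.
Proof.
elim: i m => [|i IH] m om; first exact: tauX_odd.
have MXC : M (iter m X \o iter i C) by apply: (nc_comp Mtau); exact: (nc_iter Mtau).
rewrite iter_square_defectSr tau_square_defect// IH// mulr0 sub0r.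
rewrite (iter_square_defect_sqr id)//; last exact: (nc_linear Mtau).
by rewrite IH ?oppr0//= negbK.
Qed.

(** With f = A^k, the last [A] is C - r (X B + B X) - r^2 B B. The term X B dies because tau(f X B)
    = 0, the term B X because an odd power of [X] splits off, and B B separates f from C^i. *)
Let telescope k i : tau (iter k.+1 A \o iter i C) =
  tau (iter k A \o iter i.+1 C) - (r ^+ 2)%:C * (tau (iter k A) * tau (iter i C)).
Proof.
pose f := iter k A; have pf : nc_polynomial X B f by exact: poly_Ak.
have pfX : nc_polynomial X B (f \o X) by exact: (poly_letter true).
have pfB : nc_polynomial X B (f \o B) by exact: (poly_letter false).
have [_ f2 f3] := nc_polynomial_factorization Mtau MX MB indep tauB_even tauB pf.
have mem g : nc_polynomial X B g -> M g by exact: (nc_polynomial_mem Mtau MX MB).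
have MCi : M (iter i C) by exact: (nc_iter Mtau).
have Mc g h : M g -> M h -> M (g \o h) by exact: (nc_comp Mtau).
have e : iter k.+1 A \o iter i C = f \o iter i.+1 C +
    (- r%:C) *: ((f \o X \o B \o iter i C) +
      ((f \o B \o iter 1 X \o iter i C) + r%:C *: (f \o B \o B \o iter i C))).
  apply/funext => x; rewrite [LHS]/= -iterS iterSr -/f.
  transitivity (f (iter i.+1 C x) + - r%:C *: (f (X (B (iter i C x))) + (f (B (X (iter i C x)))
     + r%:C *: f (B (B (iter i C x)))))); last by [].
  have lf := poly_linear pf.
  have lX := nc_linear Mtau MX; have lB := nc_linear Mtau MB.
  rewrite -!(linear_opZ lf) -!(linear_opD lf) -(linear_opZ lf) -(linear_opD lf).
  congr (f _); rewrite iterS; set y := iter i C x.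
  rewrite /A /C /square_defect /Y !fctE/=.
  rewrite !(linear_opD lX) !(linear_opD lB) !(linear_opZ lX) !(linear_opZ lB).
  rewrite -[RHS]addrA; congr (_ + _).
  rewrite scaleNr -opprD; congr (- _).
  by rewrite !scalerDr -!addrA.
have M1 : M (f \o X \o B \o iter i C) by apply: (Mc) => //; apply: mem; exact: (poly_letter false).
have M2 : M (f \o B \o iter 1 X \o iter i C).
  by apply: (Mc) => //; apply: mem; exact: (poly_letter true).
have M3 : M (f \o B \o B \o iter i C) by apply: (Mc) => //; apply: mem; exact: (poly_letter false).
have MZ a g : M g -> M (a *: g).
  by move=> Mg; rewrite -[X in M X]addr0; apply: (nc_lin Mtau) => //; exact: (nc0 Mtau).
have MD g h : M g -> M h -> M (g + h).
  by move=> Mg Mh; rewrite -[g]scale1r; exact: (nc_lin Mtau).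
rewrite e (tauD Mtau); last 2 first.
- by apply: (Mc); [exact: mem|exact: (nc_iter Mtau)].
- by apply: (MZ); apply: (MD) => //; apply: (MD) => //; exact: (MZ).
congr (_ + _).
rewrite (tauZ Mtau); last by apply: (MD) => //; apply: (MD) => //; exact: (MZ).
rewrite (tauD Mtau)//; last by apply: (MD) => //; exact: (MZ).
rewrite (tauD Mtau)//; last exact: (MZ).
rewrite (tauZ Mtau)//.
have h1 : tau (f \o X \o B \o iter i C) = 0.
  have -> : tau (f \o X \o B \o iter i C) = tau (f \o X \o B) * tau (iter i C)
    := factor_C i 0 pfX.
  by rewrite f2 mul0r.
have h2 : tau (f \o B \o iter 1 X \o iter i C) = 0.
  by rewrite (factor_C i 1 pf) odd_C// mulr0.
have h3 : tau (f \o B \o B \o iter i C) = tau f * tau (iter i C).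
  have -> : tau (f \o B \o B \o iter i C) = tau (f \o B \o B) * tau (iter i C)
    := factor_C i 0 pfB.
  by rewrite f3.
by rewrite h1 h2 h3 rmorphXn/=; ring.
Qed.

(* The coefficients of the resolvent identity [1 / h_s = 1 / h_0 + s], expanded
   in powers of [(l + N)^-1]. *)
Lemma rank_one_recursion j : tau (iter j A) = tau (iter j C) -
  (r ^+ 2)%:C * \sum_(k < j) tau (iter k A) * tau (iter (j.-1 - k) C).
Proof.
(* Factors [A] are traded for [C] one at a time, which requires the mixed moments of A^k C^i. *)
suff h k i : tau (iter k A \o iter i C) = tau (iter (k + i) C) -
    (r ^+ 2)%:C * \sum_(l < k) tau (iter l A) * tau (iter ((k + i).-1 - l) C).
  by have := h j 0%N; rewrite addn0.
elim: k i => [|k IH] i; first by rewrite big_ord0 mulr0 subr0.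
rewrite telescope IH addnS addSn big_ord_recr/= mulrDr opprD addrA addnC addnK.
by rewrite addnC.
Qed.

End RankOnePerturbation.

(** * The resolvent transform of the law of the square *)

Section Distributions.
Context {R : realType}.
Implicit Type mu : probability (measurableTypeR R) R.

Lemma symmetric_odd_moment mu k : symmetric_distribution mu -> odd k ->
  mu.-integrable setT (fun x : measurableTypeR R => (x ^+ k)%:E) ->
  \int[mu]_x x ^+ k = 0.
Proof.
move=> smu ok imu.
have mN : @measurable_fun _ _ (measurableTypeR R) (measurableTypeR R) setT -%R.
  exact: oppr_measurable.
have mk : measurable_fun setT (fun x : measurableTypeR R => (x ^+ k)%:E).
  by case/integrableP: imu.
have oddE : (fun x : measurableTypeR R => (x ^+ k)%:E) \o -%R =
    (fun x : measurableTypeR R => ((-1)%:E * (x ^+ k)%:E)%E).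
  by apply/funext => x /=; rewrite -EFinM exprNn -signr_odd ok expr1.
have iN : mu.-integrable setT ((fun x : measurableTypeR R => (x ^+ k)%:E) \o -%R).
  by rewrite oddE; exact: integrableZl.
suff : \int[mu]_x x ^+ k = - \int[mu]_x x ^+ k by lra.
rewrite {1}/Rintegral.
rewrite (_ : \int[mu]_x (x ^+ k)%:E = \int[pushforward mu (-%R : measurableTypeR R -> measurableTypeR R)]_x (x ^+ k)%:E)%E; last first.
  by apply: eq_measure_integral => U mU _; exact: esym (smu U mU).
rewrite (integral_pushforward mN)//= ?preimage_setT//.
rewrite [X in fine X](_ : _ = (-1)%:E * \int[mu]_x (x ^+ k)%:E)%E.
  by rewrite fineM ?mulN1r//; exact: integrable_fin_num.
by rewrite -integralZl//; apply: eq_integral => x _; have := congr1 (@^~ x) oddE.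
Qed.

Lemma symmetric_bernoulli_symmetric mu :
  symmetric_bernoulli_distribution mu -> symmetric_distribution mu.
Proof.
move=> bmu U mU; have mNU : measurable ((-%R : R -> R) @^-1` U).
  by rewrite -[X in measurable X]setTI; exact: oppr_measurable.
rewrite (bmu U mU) (bmu _ mNU) addeC !diracE.
have -> : (1 \in (-%R : R -> R) @^-1` U) = ((-1)%R \in U).
  by apply/idP/idP => /set_mem h; apply/mem_set.
have -> : ((-1)%R \in (-%R : R -> R) @^-1` U) = (1 \in U) => //.
by apply/idP/idP => /set_mem h; apply/mem_set; rewrite /preimage/= ?opprK// in h *.
Qed.

(** The law charges only x^2 = 1, where two extra powers change nothing. *)
Lemma symmetric_bernoulli_moment mu k : symmetric_bernoulli_distribution mu ->
  (forall j, mu.-integrable setT (fun x : measurableTypeR R => (x ^+ j)%:E)) ->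
  \int[mu]_x x ^+ k.+2 = \int[mu]_x x ^+ k.
Proof.
move=> bmu imu; pose E : set (measurableTypeR R) := [set x | x ^+ 2 == 1].
have mE : measurable E.
  rewrite (_ : E = [set (-1)%R] `|` [set 1%R]); first exact: measurableU.
  apply/seteqP; split=> x /=; rewrite /E/= sqrf_eq1.
    by case/orP => /eqP ->; [right|left].
  by case=> ->; rewrite eqxx ?orbT.
have nE : mu (~` E) = 0%E.
  rewrite (bmu _ (measurableC mE)) !diracE !memNset ?mule0 ?adde0//.
  - by apply; rewrite /E/= expr1n.
  - by apply; rewrite /E/= sqrrN expr1n.
have nmE := measurableC mE.
rewrite /Rintegral (negligible_integral nmE measurableT (imu k.+2) nE).
rewrite (negligible_integral nmE measurableT (imu k) nE); congr fine.
apply: eq_integral => x; rewrite setTD setCK inE /E/= => /eqP x2.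
by rewrite -addn2 exprD x2 mulr1.
Qed.

(** Markov's inequality for x^(2 k) bounds the mass by (K^2 / N)^k for every [k], and the ratio is
    below 1. *)
Lemma moment_support mu (K N : R) : 0 < K -> K ^+ 2 < N ->
  (forall k, mu.-integrable setT (fun x : measurableTypeR R => (x ^+ k)%:E)) ->
  (forall k, \int[mu]_x x ^+ (k + k) <= (K ^+ 2) ^+ k) ->
  mu [set x | ~~ (x ^+ 2 <= N)] = 0%E.
Proof.
move=> K0 KN imu mK; set E := [set x | _].
have N0 : 0 < N by apply: lt_trans KN; rewrite exprn_gt0.
have mE : measurable (E : set (measurableTypeR R)).
  have -> : E = (fun x : R => x ^+ 2) @^-1` [set` `]N, +oo[].
    by apply/seteqP; split=> x; rewrite /E/= in_itv/= andbT ltNge.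
  by rewrite -[X in measurable X]setTI; apply: exprn_measurable.
have Efin := fin_num_measure mu E mE.
have E_ge0 : 0 <= fine (mu E) by apply: fine_ge0.
have Ele k : fine (mu E) <= (K ^+ 2 / N) ^+ k.
  have Nk : 0 < N ^+ k by rewrite exprn_gt0.
  rewrite expr_div_n ler_pdivlMr// mulrC; apply: le_trans (mK k).
  rewrite -lee_fin EFinM fineK//.
  have mkk : measurable_fun setT (fun x : measurableTypeR R => (x ^+ (k + k))%:E).
    by case/integrableP: (imu (k + k)%N).
  have := le_integral_abse mu measurableT mkk Nk; rewrite setTI => h.
  rewrite /Rintegral fineK; last exact: integrable_fin_num.
  have -> : (\int[mu]_x (x ^+ (k + k))%:E = \int[mu]_x `|(x ^+ (k + k))%:E|)%E.
    by apply: eq_integral => x _; rewrite addnn -mul2n exprM gee0_abs// lee_fin exprn_ge0// sqr_ge0.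
  apply: le_trans h; rewrite lee_pmul2l//; apply: le_measure; rewrite ?inE//.
    rewrite -[X in measurable X]setTI; apply: emeasurable_fun_c_infty => //.
    exact: measurableT_comp.
  move=> x; rewrite /E/= -ltNge => Nx; rewrite lee_fin addnn -mul2n exprM ger0_norm.
    by rewrite lerXn2r// ?nnegrE ?sqr_ge0 ?ltW.
  by rewrite exprn_ge0// sqr_ge0.
suff e0 : fine (mu E) = 0 by rewrite -[mu E]fineK// e0.
apply/eqP; rewrite eq_le E_ge0 andbT.
have q1 : `|K ^+ 2 / N| < 1.
  by rewrite ger0_norm ?divr_ge0 ?sqr_ge0 ?ltW// ltr_pdivrMr// mul1r.
apply: (@closed_cvg _ _ \oo _ (fun k => (K ^+ 2 / N) ^+ k) (fun x : R => fine (mu E) <= x)).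
- exact: closed_ge.
- exact: nearW.
- exact: cvg_expr.
Qed.

End Distributions.

Section ConvolutionEquation.
Context {R : realType}.
Variables (s : R) (a b : nat -> R).
Hypotheses (s_ge0 : 0 <= s) (a_ge0 : forall j, 0 <= a j) (b_ge0 : forall j, 0 <= b j).
Hypothesis bE : forall j, b j = a j - s * \sum_(k < j) b k * a (j.-1 - k)%N.

Let PA (n : nat) : R := \sum_(j < n) a j.
Let PB (n : nat) : R := \sum_(j < n) b j.
(* [T n] is the sum of [b k * a i] over [k + i + 1 < n]. *)
Let T (n : nat) : R := \sum_(k < n) b k * PA (n.-1 - k)%N.

Let partial_sumE n : PB n = PA n - s * T n.
Proof.
elim: n => [|n IH]; first by rewrite /PA /PB /T !big_ord0 mulr0 subr0.
rewrite /PB big_ord_recr/= -/(PB n) IH /T [in RHS]big_ord_recr/= subnn.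
rewrite [PA 0]big_ord0 mulr0 addr0 bE /PA big_ord_recr/= -/(PA n).
have -> : \sum_(k < n) b k * \sum_(j < n - k) a j =
    \sum_(k < n) b k * PA (n.-1 - k)%N + \sum_(k < n) b k * a (n.-1 - k)%N.
  rewrite -big_split/=; apply: eq_bigr => k _.
  have -> : (n - k = (n.-1 - k).+1)%N by have := ltn_ord k; lia.
  by rewrite big_ord_recr/= mulrDr.
by ring.
Qed.

Let PA_homo : {homo PA : m n / (m <= n)%N >-> m <= n}.
Proof.
move=> m n /subnKC <-; rewrite /PA -!(big_mkord xpredT a).
by rewrite [leRHS](big_cat_nat (leq0n m)) ?leq_addr//= lerDl sumr_ge0.
Qed.

Let T_le n : T n <= PB n * PA n.
Proof.
rewrite /PB mulr_suml; apply: ler_sum => k _; rewrite ler_wpM2l//.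
by apply: PA_homo; lia.
Qed.

Let T_ge m : PB m * PA m <= T (2 * m).
Proof.
rewrite /T -(big_mkord xpredT (fun k => b k * PA ((2 * m).-1 - k)%N)).
rewrite (big_cat_nat (leq0n m)) ?leq_pmull//=.
rewrite -[leLHS]addr0 lerD//; last first.
  by apply: sumr_ge0 => k _; rewrite mulr_ge0// sumr_ge0.
rewrite big_mkord /PB mulr_suml; apply: ler_sum => k _; rewrite ler_wpM2l//.
by apply: PA_homo; have := ltn_ord k; lia.
Qed.

(** [T n] sums over a triangle inside the square of side n, and for n = 2 m the triangle contains
    the square of side m. By nonnegativity the square sums enclose [T], and both tend to hB hA. *)
Lemma convolution_limit (hA hB : R) :
  (\sum_(j < n) a j) @[n --> \oo] --> hA -> (\sum_(j < n) b j) @[n --> \oo] --> hB ->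
  hB = hA - s * (hB * hA).
Proof.
move=> cA cB.
have dbl : (2 * m)%N @[m --> \oo] --> \oo by exact: cvg_mulnl.
have cA2 : PA (2 * m)%N @[m --> \oo] --> hA by exact: (@cvg_comp _ _ _ (fun m => (2 * m)%N) PA _ _ _ dbl cA).
have cB2 : PB (2 * m)%N @[m --> \oo] --> hB by exact: (@cvg_comp _ _ _ (fun m => (2 * m)%N) PB _ _ _ dbl cB).
have sTE n : s * T n = PA n - PB n by rewrite partial_sumE; ring.
apply/eqP; rewrite eq_le; apply/andP; split.
  rewrite -subr_ge0.
  apply: (@closed_cvg _ _ \oo _ (fun m => (PA (2 * m)%N - s * (PB m * PA m)) - PB (2 * m)%N)
    (fun x : R => 0 <= x)).
  - exact: closed_ge.
  - by apply: nearW => m; rewrite addrAC -sTE subr_ge0 ler_wpM2l.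
  - apply: cvgB => //; apply: cvgB => //; apply: cvgM; first exact: cvg_cst.
    exact: cvgM.
rewrite -subr_ge0.
apply: (@closed_cvg _ _ \oo _ (fun m => PB m - (PA m - s * (PB m * PA m)))
  (fun x : R => 0 <= x)).
- exact: closed_ge.
- apply: nearW => m.
  have -> : PB m - (PA m - s * (PB m * PA m)) = s * (PB m * PA m - T m).
    by rewrite mulrBr sTE; ring.
  by rewrite mulr_ge0// subr_ge0.
- apply: cvgB => //; apply: cvgB => //; apply: cvgM; first exact: cvg_cst.
  exact: cvgM.
Qed.

End ConvolutionEquation.

(* The integrand [(l + x ^+ 2)^-1] of [- G (- l)], where [G] is the Cauchy
   transform of the law of the square, extended by [0] to [l <= 0]. *)
Definition resolvent {R : realType} (x l : R) : R := if 0 < l then (l + x ^+ 2)^-1 else 0.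

Definition resolvent_transform {R : realType} (mu : probability (measurableTypeR R) R)
  (l : R) : R := \int[mu]_x resolvent x l.

Section ResolventTransform.
Context {R : realType}.

Lemma resolventE (x l : R) : 0 < l -> resolvent x l = (l + x ^+ 2)^-1.
Proof. by rewrite /resolvent => ->. Qed.

Lemma resolvent_ge0 (x l : R) : 0 <= resolvent x l.
Proof.
rewrite /resolvent; case: ifP => // l0.
by rewrite invr_ge0 addr_ge0 ?sqr_ge0// ltW.
Qed.

Lemma resolvent_le (x l : R) : 0 < l -> resolvent x l <= l^-1.
Proof.
move=> l0; rewrite resolventE// lef_pV2 ?posrE// ?lerDl ?sqr_ge0//.
by rewrite ltr_pwDl// sqr_ge0.
Qed.

(** [powR] with exponent -1 is measurable and agrees with inversion on nonnegative numbers, 0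
    included; negative values follow by oddness. *)
Lemma measurable_inv d (T : measurableType d) (f : T -> R) :
  measurable_fun setT f -> measurable_fun setT (fun x => (f x)^-1).
Proof.
move=> mf; rewrite (_ : (fun _ => _) = (fun x =>
    if 0 <= f x then powR (f x) (-1) else - powR (- f x) (-1))); last first.
  apply/funext => x; case: ifPn => h; first by rewrite powR_inv1.
  by rewrite powR_inv1 ?invrN ?opprK// oppr_ge0 ltW// ltNge.
apply: measurable_fun_ifT => //=.
- exact: measurable_fun_ler.
- exact: (measurableT_comp (measurable_powR (-1)) mf).
- apply: measurableT_comp => //.
  by apply: (measurableT_comp (measurable_powR (-1))); exact: measurableT_comp.
Qed.

Lemma measurable_resolvent :
  measurable_fun setT (fun z : measurableTypeR R * measurableTypeR R => resolvent z.1 z.2).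
Proof.
rewrite /resolvent; apply: measurable_fun_ifT => //=.
  by apply: measurable_fun_ltr => //; exact: measurable_snd.
apply: measurable_inv; apply: measurable_funD; first exact: measurable_snd.
by apply: measurable_funX; exact: measurable_fst.
Qed.

Lemma measurable_resolvent1 (l : R) :
  measurable_fun setT (fun x : measurableTypeR R => resolvent x l).
Proof. exact: (measurableT_comp measurable_resolvent (pair2_measurable l)). Qed.

Lemma measurable_resolvent2 (x : R) :
  measurable_fun setT (fun l : measurableTypeR R => resolvent x l).
Proof. exact: (measurableT_comp measurable_resolvent (pair1_measurable x)). Qed.

Variable mu : probability (measurableTypeR R) R.

Lemma integrable_resolvent (l : R) :
  mu.-integrable setT (EFin \o (fun x : R => resolvent x l)).
Proof.
apply: (@bounded_integrable_probability _ _ _ mu _ `|l^-1|).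
  exact: measurable_resolvent1.
move=> x; rewrite ger0_norm ?resolvent_ge0//.
have [l0|l0] := ltP 0 l; first by rewrite (le_trans (resolvent_le _ l0))// ler_norm.
by rewrite /resolvent ltNge l0 /=.
Qed.

Lemma resolvent_transform_ge0 l : 0 <= resolvent_transform mu l.
Proof. by apply: Rintegral_ge0 => x _; exact: resolvent_ge0. Qed.

Lemma Rintegral_negligible (f : R -> R) (E : set (measurableTypeR R)) :
  measurable E -> mu E = 0%E -> mu.-integrable setT (EFin \o f) ->
  \int[mu]_x f x = \int[mu]_(x in ~` E) f x.
Proof.
move=> mE E0 fi; rewrite /Rintegral (negligible_integral mE measurableT fi E0).
by rewrite setTD.
Qed.

Variable N : R.
Let E : set (measurableTypeR R) := [set x | ~~ (x ^+ 2 <= N)].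
Hypotheses (N_gt0 : 0 < N) (E0 : mu E = 0%E).
Hypothesis intN : forall j, mu.-integrable setT (EFin \o (fun x : R => (N - x ^+ 2) ^+ j)).

Lemma measurable_square_gt : measurable E.
Proof.
have -> : E = (fun x : R => x ^+ 2) @^-1` [set` `]N, +oo[].
  by apply/seteqP; split=> x; rewrite /E/= in_itv/= andbT ltNge.
by rewrite -[X in measurable X]setTI; apply: exprn_measurable.
Qed.

Lemma defect_moment_ge0 j : 0 <= \int[mu]_x (N - x ^+ 2) ^+ j.
Proof.
rewrite (Rintegral_negligible measurable_square_gt E0)//.
apply: Rintegral_ge0 => x; rewrite /E/= => /negP; rewrite negbK => xN.
by rewrite exprn_ge0// subr_ge0.
Qed.

(** On the support x^2 <= N. This positive lower bound is what makes the increase of the entropy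
    strict. *)
Lemma resolvent_transform_ge l : 0 < l -> (l + N)^-1 <= resolvent_transform mu l.
Proof.
move=> l0; have lN : 0 < l + N by rewrite addr_gt0.
rewrite /resolvent_transform (Rintegral_negligible measurable_square_gt E0); last first.
  exact: integrable_resolvent.
have mE := measurable_square_gt.
apply: (@le_trans _ _ (\int[mu]_(x in ~` E) (l + N)^-1)).
  rewrite Rintegral_cst//; last exact: measurableC.
  by rewrite /= probability_setC// E0 sube0 mulr1.
apply: le_Rintegral.
- exact: measurableC.
- apply: integrableS (@bounded_integrable_probability _ _ _ mu (cst (l + N)^-1) (l + N)^-1 _ _) => //.
    exact: measurableC.
  by move=> x; rewrite ger0_norm// invr_ge0 ltW.
- apply: integrableS (integrable_resolvent l) => //; exact: measurableC.
move=> x; rewrite /E/= => /negP; rewrite negbK => xN.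
have lx : 0 < l + x ^+ 2 by rewrite ltr_pwDl// sqr_ge0.
by rewrite resolventE// lef_pV2 ?posrE// lerD2l.
Qed.

(** After [n] terms of the geometric series the remainder is exactly [e n]. On the support it is at
    most q^n / l with q = N / (l + N) < 1, and the complement is null. *)
Lemma resolvent_transform_series l : 0 < l ->
  (\sum_(j < n) (l + N)^-1 ^+ j.+1 * \int[mu]_x (N - x ^+ 2) ^+ j) @[n --> \oo] -->
  resolvent_transform mu l.
Proof.
move=> l0; set z := (l + N)^-1; pose q := N * z.
have lN : 0 < l + N by rewrite addr_gt0.
have z0 : 0 < z by rewrite invr_gt0.
have q0 : 0 <= q by rewrite mulr_ge0// ltW.
have q1 : q < 1 by rewrite /q ltr_pdivrMr// mul1r ltrDr.
pose e n (x : R) := ((N - x ^+ 2) * z) ^+ n * resolvent x l.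
pose PA n := \sum_(j < n) z ^+ j.+1 * \int[mu]_x (N - x ^+ 2) ^+ j.
have eP n : mu.-integrable setT (EFin \o e n) /\
    \int[mu]_x e n x = resolvent_transform mu l - PA n.
  elim: n => [|n [IH1 IH2]].
    have -> : e 0%N = (fun x => resolvent x l) by apply/funext => x; rewrite /e expr0 mul1r.
    by rewrite /PA big_ord0 subr0; split; [exact: integrable_resolvent|].
  have eS : e n.+1 = (fun x => e n x - z ^+ n.+1 * (N - x ^+ 2) ^+ n).
    apply/funext => x; rewrite /e resolventE// !exprMn !exprS /z.
    have lx : l + x ^+ 2 != 0 by rewrite gt_eqF// ltr_pwDl// sqr_ge0.
    set u := (_^-1) ^+ n; set v := (N - x ^+ 2) ^+ n; field.
    by rewrite lx gt_eqF.
  have iz : mu.-integrable setT (EFin \o (fun x => z ^+ n.+1 * (N - x ^+ 2) ^+ n)).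
    rewrite (_ : _ \o _ = fun x => ((z ^+ n.+1)%:E * (EFin \o (fun x => (N - x ^+ 2) ^+ n)%R) x)%E)//.
    exact: integrableZl.
  rewrite eS; split.
    rewrite (_ : _ \o _ = (fun x => (EFin \o e n) x -
      (EFin \o (fun x => z ^+ n.+1 * (N - x ^+ 2) ^+ n)%R) x)%E)//.
    exact: integrableB.
  by rewrite RintegralB// IH2 RintegralZl// /PA big_ord_recr/= opprD addrA.
have err n : `|resolvent_transform mu l - PA n| <= q ^+ n * l^-1.
  have [ei <-] := eP n; have mE := measurable_square_gt.
  have mEC := measurableC mE.
  rewrite (Rintegral_negligible mE E0)//.
  have eiE : mu.-integrable (~` E) (EFin \o e n) by apply: integrableS ei.
  apply: (le_trans (le_normr_Rintegral mEC eiE)).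
  apply: (@le_trans _ _ (\int[mu]_(x in ~` E) (q ^+ n * l^-1))); last first.
    by rewrite Rintegral_cst//= probability_setC// E0 sube0 mulr1.
  apply: le_Rintegral => //.
  - exact: integrable_norm.
  - apply: integrableS (@bounded_integrable_probability _ _ _ mu (cst (q ^+ n * l^-1)) (q ^+ n * l^-1) _ _) => //.
    by move=> x; rewrite ger0_norm// mulr_ge0 ?exprn_ge0// invr_ge0 ltW.
  move=> x; rewrite /E/= => /negP; rewrite negbK => xN.
  rewrite normrM (ger0_norm (resolvent_ge0 _ _)) ler_pM ?resolvent_ge0 ?resolvent_le//.
  have h : 0 <= (N - x ^+ 2) * z by rewrite mulr_ge0 ?subr_ge0// ltW.
  rewrite normrX ger0_norm// lerXn2r ?nnegrE// ler_wpM2r ?(ltW z0)//.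
  by rewrite gerBl sqr_ge0.
apply/cvgrPdist_le => eps eps0.
have cq : q ^+ n * l^-1 @[n --> \oo] --> 0 * l^-1.
  by apply: cvgM; [apply: cvg_expr; rewrite ger0_norm|exact: cvg_cst].
rewrite mul0r in cq.
move/cvgrPdist_le: cq => /(_ eps eps0); apply: filterS => n.
rewrite sub0r normrN ger0_norm; first exact: le_trans (err n).
by rewrite mulr_ge0 ?exprn_ge0// invr_ge0 ltW.
Qed.

End ResolventTransform.

Section ResolventEquation.
Context {R : realType} {H : completeNormedModType R[i]}.
Variables (dot : {dot H for Num.conj}) (M : set (H -> H)) (tau : (H -> H) -> R[i]).
Hypothesis Mtau : nc_probability_space dot M tau.

Lemma law_integrable Y k : M Y -> selfadjoint dot Y ->
  (law tau Y).-integrable setT (fun x : measurableTypeR R => (x ^+ k)%:E).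
Proof. by move=> MY sY; have [] := lawP Mtau MY sY k. Qed.

Lemma law_support Y : M Y -> selfadjoint dot Y -> exists2 N0 : R, 0 < N0 &
  forall N, N0 <= N -> law tau Y [set x | ~~ (x ^+ 2 <= N)] = 0%E.
Proof.
move=> MY sY; have [K K0 Kmom] := law_even_moment_le Mtau MY sY.
exists (K ^+ 2 + 1); first by rewrite ltr_pwDr// sqr_ge0.
move=> N KN; apply: (@moment_support _ _ K) => //.
- by apply: lt_le_trans KN; rewrite ltrDl.
- by move=> k; exact: law_integrable.
Qed.

Lemma law_defect_moment Y N j : M Y -> selfadjoint dot Y ->
  (law tau Y).-integrable setT (EFin \o (fun x => (N - x ^+ 2) ^+ j)) /\
  tau (iter j (square_defect N Y)) = (\int[law tau Y]_x (N - x ^+ 2) ^+ j)%:C.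
Proof.
move=> MY sY; have := law_square_defect_moment Mtau N 0 j MY sY.
have -> : (fun x : R => x ^+ 0 * (N - x ^+ 2) ^+ j) = (fun x => (N - x ^+ 2) ^+ j).
  by apply/funext => x; rewrite expr0 mul1r.
by [].
Qed.

Variables (X B : H -> H) (r : R).
Hypotheses (MX : M X) (saX : selfadjoint dot X) (MB : M B) (saB : selfadjoint dot B).
Hypothesis symX : symmetric_distribution (law tau X).
Hypothesis indep : boolean_independent tau X B.
Hypothesis lawB : symmetric_bernoulli_distribution (law tau B).

Let Y : H -> H := X + r%:C *: B.

Lemma perturbation_mem : M Y.
Proof. by rewrite /Y addrC; exact: (nc_lin Mtau). Qed.

Lemma perturbation_selfadjoint : selfadjoint dot Y.
Proof. by rewrite /Y addrC; exact: selfadjoint_lin. Qed.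

Lemma resolvent_equation l : 0 < l ->
  resolvent_transform (law tau Y) l = resolvent_transform (law tau X) l -
    r ^+ 2 * (resolvent_transform (law tau Y) l * resolvent_transform (law tau X) l).
Proof.
move=> l0; have MY := perturbation_mem; have sY := perturbation_selfadjoint.
have [N1 N10 supX] := law_support MX saX.
have [N2 N20 supY] := law_support MY sY.
(* The recursion compares coefficients of the same powers of (l + N)^-1, so one [N] has to bound
   both supports. *)
pose N := Num.max N1 N2.
have N0 : 0 < N by rewrite lt_max N10.
have EX : law tau X [set x | ~~ (x ^+ 2 <= N)] = 0%E by apply: supX; rewrite le_max lexx.
have EY : law tau Y [set x | ~~ (x ^+ 2 <= N)] = 0%E by apply: supY; rewrite le_max lexx orbT.
have iX j := (law_defect_moment N j MX saX).1.
have iY j := (law_defect_moment N j MY sY).1.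
have tX j := (law_defect_moment N j MX saX).2.
have tY j := (law_defect_moment N j MY sY).2.
have z0 : 0 < (l + N)^-1 by rewrite invr_gt0 addr_gt0.
apply: (@convolution_limit _ _ (fun j => (l + N)^-1 ^+ j.+1 * \int[law tau X]_x (N - x ^+ 2) ^+ j)
  (fun j => (l + N)^-1 ^+ j.+1 * \int[law tau Y]_x (N - x ^+ 2) ^+ j)).
- exact: sqr_ge0.
- by move=> j; rewrite mulr_ge0 ?exprn_ge0 ?(ltW z0)//; exact: defect_moment_ge0.
- by move=> j; rewrite mulr_ge0 ?exprn_ge0 ?(ltW z0)//; exact: defect_moment_ge0.
- move=> j.
  have tauB_even k : tau (iter k.+2 B) = tau (iter k B).
    rewrite !(law_moment Mtau MB saB) symmetric_bernoulli_moment// => i.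
    exact: law_integrable.
  have tauB0 : tau B = 0.
    rewrite -[B in LHS]/(iter 1 B) (law_moment Mtau MB saB) symmetric_odd_moment//.
      exact: symmetric_bernoulli_symmetric.
    exact: law_integrable.
  have tauX0 k : odd k -> tau (iter k X) = 0.
    move=> ok; rewrite (law_moment Mtau MX saX) symmetric_odd_moment//.
    exact: law_integrable.
  have := rank_one_recursion Mtau r MX MB indep tauB_even tauB0 tauX0 N j.
  rewrite -/Y tX tY.
  under eq_bigr do rewrite tX tY -rmorphM/=.
  rewrite -rmorph_sum -rmorphM -rmorphB/= => /(congr1 (@complex.Re R))/= ->.
  rewrite mulrBr mulrCA; congr (_ - _ * _); rewrite mulr_sumr.
  apply: eq_bigr => k _.
  (* The two coefficients carry the exponents k + 1 and j - k, which add up to j + 1. *)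
  have {1}-> : j = (k + (j.-1 - k).+1)%N by have := ltn_ord k; lia.
  by rewrite -addSn exprD mulrACA.
- exact: resolvent_transform_series.
- exact: resolvent_transform_series.
Qed.

End ResolventEquation.

(** * Fisher information and entropy as integrals of the transform *)

Section KernelIntegral.
Context {R : realType}.
Notation leb := (@lebesgue_measure R).

Lemma ln_shift_diff_cvg (a b : R) : 0 < a -> 0 < b ->
  (ln (x + a) - ln (x + b)) @[x --> +oo] --> (0 : R).
Proof.
move=> a0 b0.
have c1 : (1 + (a - b) / (x + b)) @[x --> +oo] --> (1 + 0 : R).
  apply: cvgD; first exact: cvg_cst.
  rewrite -(mulr0 (a - b)); apply: cvgM; first exact: cvg_cst.
  apply/gtr0_cvgV0; last exact: cvg_addrr.
  by near=> x; rewrite addr_gt0.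
have c2 : (ln (1 + (a - b) / (x + b))) @[x --> +oo] --> (0 : R).
  rewrite -(@ln1 R) -[X in ln X]addr0; apply: continuous_cvg => //.
  by apply: continuous_ln; rewrite addr0.
apply: cvg_trans c2; apply: near_eq_cvg; near=> x.
have xa : 0 < x + a by rewrite addr_gt0.
have xb : 0 < x + b by rewrite addr_gt0.
rewrite -ln_div ?posrE//; congr ln; field.
by rewrite gt_eqF.
Unshelve. all: by end_near. Qed.

Lemma integral_ge0_primitive (f F : R -> R) :
  (forall x : R, 0 <= x -> 0 <= f x) -> (forall x : R, 0 <= x -> {for x, continuous f} /\ is_derive x 1 F (f x)) -> F x @[x --> +oo] --> (0 : R) ->
  (\int[leb]_(x in `[0%R, +oo[) (f x)%:E = (- F 0)%:E)%E.
Proof.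
move=> f0 cdF F0; have dF (x : R) : 0 <= x -> is_derive x 1 F (f x) by move=> /cdF[].
have dF1 (x : R) : 0 <= x -> derivable F x 1 by move=> /dF[].
rewrite (@ge0_continuous_FTC2y _ _ F _ 0).
- by rewrite sub0e.
- exact: f0.
- apply: continuous_in_subspaceT => y; rewrite inE/= in_itv/= andbT => /cdF[cf _]; exact: cf.
- exact: F0.
- by move=> y /ltW; exact: dF1.
- apply: cvg_at_right_filter; apply: differentiable_continuous.
  by apply/derivable1_diffP; exact: dF1.
- move=> x; rewrite in_itv/= andbT => /ltW x0.
  by rewrite derive1E; have [_ ->] := dF _ x0.
Qed.

Let cont_shiftV (a x : R) : 0 < a -> 0 <= x -> {for x, continuous (fun y => (y + a)^-1)}.
Proof.
move=> a0 x0; apply: continuousV; first by rewrite gt_eqF// ltr_wpDl.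
by apply: continuousD => //; exact: cst_continuous.
Qed.

Let derive_shift (a x : R) : is_derive x 1 (fun y => y + a) 1.
Proof. by apply: is_derive_eq; rewrite addr0. Qed.

Let derive_ln_shift (a x : R) : 0 < a -> 0 <= x ->
  is_derive x 1 (fun y => ln (y + a)) (x + a)^-1.
Proof.
move=> a0 x0; have xa : 0 < x + a by rewrite ltr_wpDl.
have := @is_derive1_comp _ _ (fun y => y + a) x _ _ (is_derive1_ln xa) (derive_shift a x).
by rewrite mulr1.
Qed.

Lemma integral_resolvent_product (a b : R) : 0 < a -> 0 < b -> a != b ->
  (\int[leb]_(x in `[0%R, +oo[) ((x + a)^-1 * (x + b)^-1)%:E =
   ((ln a - ln b) / (a - b))%:E)%E.
Proof.
move=> a0 b0 ab; have ba : b - a != 0 by rewrite subr_eq0 eq_sym.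
rewrite (@integral_ge0_primitive _ (fun x => (b - a)^-1 * (ln (x + a) - ln (x + b)))).
- by rewrite !add0r -mulNr -invrN opprB mulrC.
- by move=> x x0; rewrite mulr_ge0// invr_ge0 addr_ge0// ltW.
- move=> x x0; split; first by apply: continuousM; exact: cont_shiftV.
  have d1 := derive_ln_shift a0 x0; have d2 := derive_ln_shift b0 x0.
  have xa : x + a != 0 by rewrite gt_eqF// ltr_wpDl.
  have xb : x + b != 0 by rewrite gt_eqF// ltr_wpDl.
  apply: is_derive_eq; rewrite /GRing.scale/=; field.
  by rewrite xa xb ba.
- rewrite -(mulr0 (b - a)^-1); apply: cvgM; first exact: cvg_cst.
  exact: ln_shift_diff_cvg.
Qed.

Lemma integral_resolvent_sqr (a : R) : 0 < a ->
  (\int[leb]_(x in `[0%R, +oo[) ((x + a)^-1 * (x + a)^-1)%:E = a^-1%:E)%E.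
Proof.
move=> a0; rewrite (@integral_ge0_primitive _ (fun x => - (x + a)^-1)).
- by rewrite add0r opprK.
- by move=> x x0; rewrite mulr_ge0// invr_ge0 addr_ge0// ltW.
- move=> x x0; split; first by apply: continuousM; exact: cont_shiftV.
  have xa : x + a != 0 by rewrite gt_eqF// ltr_wpDl.
  have d1 := derive_shift a x.
  have d2 := @is_deriveV _ (fun y => y + a) x _ _ xa d1.
  apply: is_derive_eq; rewrite /GRing.scale/=; field.
  by rewrite xa.
- rewrite -oppr0; apply: cvgN; apply/gtr0_cvgV0; last exact: cvg_addrr.
  by near=> x; rewrite addr_gt0.
Unshelve. all: by end_near. Qed.

End KernelIntegral.

Section FisherKernel.
Context {R : realType}.
Notation leb := (@lebesgue_measure R).

Let measurable_prod (D : set R) (a b : R) :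
  measurable_fun D (fun l : R => ((l + a)^-1 * (l + b)^-1)%:E).
Proof.
apply/measurable_EFinP; apply: measurable_funTS.
by apply: measurable_funM; apply: measurable_inv; apply: measurable_funD => //; exact: measurable_id.
Qed.

Lemma integral_resolventE (a b : R) :
  (\int[leb]_l (resolvent a l * resolvent b l)%:E =
   \int[leb]_(l in `[0%R, +oo[) ((l + a ^+ 2)^-1 * (l + b ^+ 2)^-1)%:E)%E.
Proof.
rewrite -integral_itv_obnd_cbnd; last exact: measurable_prod.
rewrite [RHS]integral_mkcond; apply: eq_integral => l _.
rewrite /patch mem_setE in_itv/= andbT /resolvent.
by case: ifP => //; rewrite mul0r.
Qed.

Lemma integral_singular_resolvent (b : R) : 0 <= b ->
  (\int[leb]_(l in `[0%R, +oo[) ((l + 0)^-1 * (l + b)^-1)%:E = +oo)%E.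
Proof.
move=> b0; apply/eqyP => C C0.
(* Raising 0 to [a'] and [b] to [b'] decreases the integral to (ln b' - ln a') / (b' - a') = b' C /
   (b' - a'), which is still at least [C]. *)
pose b' := b + 1; pose a' := b' * expR (- (b' * C)).
have b'0 : 0 < b' by rewrite ltr_wpDl.
have a'0 : 0 < a' by rewrite mulr_gt0// expR_gt0.
have ab : a' < b'.
  by rewrite /a' gtr_pMr// -expR0 ltr_expR oppr_lt0 mulr_gt0.
have := integral_resolvent_product a'0 b'0 (negbT (lt_eqF ab)).
rewrite -integral_itv_obnd_cbnd; last exact: measurable_prod.
rewrite -integral_itv_obnd_cbnd; last exact: measurable_prod.
move=> e; apply: (@le_trans _ _ ((ln a' - ln b') / (a' - b'))%:E).
  rewrite lee_fin /a' lnM ?posrE ?expR_gt0// expRK addrAC subrr add0r.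
  rewrite -/a' -mulrNN -invrN opprK opprB ler_pdivlMr ?subr_gt0//.
  by rewrite mulrC ler_wpM2r ?(ltW C0)// gerBl ltW.
rewrite -e; apply: ge0_le_integral => //.
- move=> l /=; rewrite in_itv/= andbT => l0.
  by rewrite lee_fin mulr_ge0// invr_ge0 addr_ge0// ltW.
- exact: measurable_prod.
- exact: measurable_prod.
- move=> l /=; rewrite in_itv/= andbT => l0.
  rewrite lee_fin addr0 ler_pM ?invr_ge0 ?addr_ge0 ?(ltW l0) ?(ltW a'0) ?(ltW b'0)//.
    by rewrite lef_pV2 ?posrE ?addr_gt0// lerDl ltW.
  have lb : 0 < l + b by rewrite ltr_pwDl.
  by rewrite lef_pV2 ?posrE ?(addr_gt0 l0 b'0)// lerD2l lerDl.
Qed.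

(** One integral accounts for all branches: a zero argument contributes the factor 1 / l, which
    diverges at 0, and equal squares give the integral of (l + x^2)^-2. *)
Lemma fisher_kernelE (x y : R) :
  (fisher_kernel x y = \int[leb]_l (resolvent x l * resolvent y l)%:E)%E.
Proof.
rewrite integral_resolventE /fisher_kernel.
have [->|x0] := eqVneq x 0 => /=.
  by rewrite expr0n/= integral_singular_resolvent// sqr_ge0.
have [->|y0] := eqVneq y 0 => /=.
  under eq_integral do rewrite mulrC.
  by rewrite expr0n/= integral_singular_resolvent// sqr_ge0.
have x20 : 0 < x ^+ 2 by rewrite exprn_even_gt0.
have y20 : 0 < y ^+ 2 by rewrite exprn_even_gt0.
case: eqVneq => [<-|xy]; first by rewrite integral_resolvent_sqr.
by rewrite integral_resolvent_product.
Qed.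

End FisherKernel.

Section FisherEntropy.
Context {R : realType}.
Notation leb := (@lebesgue_measure R).
Variable mu : probability (measurableTypeR R) R.
Let h (l : R) : R := resolvent_transform mu l.

Let resolvent_intE l : (\int[mu]_x (resolvent x l)%:E = (h l)%:E)%E.
Proof. by rewrite /h /resolvent_transform /Rintegral fineK//; exact: integrable_fin_num (integrable_resolvent mu l). Qed.

Lemma measurable_resolvent_transform :
  @measurable_fun _ _ (measurableTypeR R) (measurableTypeR R) setT (resolvent_transform mu).
Proof.
apply/measurable_EFinP.
rewrite (_ : EFin \o _ = fubini_G mu
  (fun z : measurableTypeR R * measurableTypeR R => (resolvent z.1 z.2)%:E)); last first.
  by apply/funext => l; rewrite /fubini_G/= resolvent_intE.
apply: measurable_fun_fubini_tonelli_G.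
  by apply/measurable_EFinP; exact: measurable_resolvent.
by move=> z; rewrite lee_fin resolvent_ge0.
Qed.

Lemma resolvent_transform_nonpos l : l <= 0 -> resolvent_transform mu l = 0.
Proof.
move=> l0; rewrite /resolvent_transform (_ : (fun _ => _) = cst 0).
  by rewrite Rintegral_cst// mul0r.
by apply/funext => x; rewrite /resolvent ltNge l0.
Qed.

Lemma fisher_integralE :
  (\int[mu \x mu]_z fisher_kernel z.1 z.2 = \int[leb]_l (h l ^+ 2)%:E)%E.
Proof.
have mres := @measurable_resolvent R.
have mh := measurable_resolvent_transform.
rewrite fubini_tonelli1; last 2 first.
(* The kernel is measurable as a partial integral of a nonnegative measurable function, whatever its
   case distinction. *)
- rewrite (_ : (fun z => _) = fubini_F leb
    (fun w : (measurableTypeR R * measurableTypeR R) * measurableTypeR R =>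
      (resolvent w.1.1 w.2 * resolvent w.1.2 w.2)%:E)); last first.
    by apply/funext => z; rewrite fisher_kernelE.
  apply: measurable_fun_fubini_tonelli_F => [|w].
    apply/measurable_EFinP; apply: measurable_funM.
      apply: (measurableT_comp mres (g := fun w : (measurableTypeR R * measurableTypeR R) * measurableTypeR R => (w.1.1, w.2))).
      by apply: measurable_fun_pair => //; exact: (measurableT_comp measurable_fst measurable_fst).
    apply: (measurableT_comp mres (g := fun w : (measurableTypeR R * measurableTypeR R) * measurableTypeR R => (w.1.2, w.2))).
    by apply: measurable_fun_pair => //; exact: (measurableT_comp measurable_snd measurable_fst).
  by rewrite lee_fin mulr_ge0 ?resolvent_ge0.
- move=> z; rewrite fisher_kernelE; apply: integral_ge0 => l _.
  by rewrite lee_fin mulr_ge0 ?resolvent_ge0.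
transitivity (\int[mu]_x \int[leb]_l (resolvent x l * h l)%:E)%E.
  apply: eq_integral => x _; rewrite /fubini_F/=.
  under eq_integral do rewrite fisher_kernelE.
  rewrite (fubini_tonelli (m1 := mu) (m2 := leb)
    (fun z : measurableTypeR R * measurableTypeR R => (resolvent x z.2 * resolvent z.1 z.2)%:E))/=.
  - apply: eq_integral => l _; under eq_integral do rewrite EFinM.
    rewrite ge0_integralZl//= ?resolvent_intE ?EFinM//.
    + by apply/measurable_EFinP; exact: measurable_resolvent1.
    + by move=> y _; rewrite lee_fin resolvent_ge0.
    + by rewrite lee_fin resolvent_ge0.
  - apply/measurable_EFinP; apply: measurable_funM => //.
    exact: (measurableT_comp (measurable_resolvent2 x) measurable_snd).
  - by move=> z; rewrite lee_fin mulr_ge0 ?resolvent_ge0.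
rewrite (fubini_tonelli (m1 := mu) (m2 := leb)
  (fun z : measurableTypeR R * measurableTypeR R => (resolvent z.1 z.2 * h z.2)%:E))/=.
- apply: eq_integral => l _; under eq_integral do rewrite mulrC EFinM.
  rewrite ge0_integralZl//= ?resolvent_intE ?EFinM//.
  + by apply/measurable_EFinP; exact: measurable_resolvent1.
  + by move=> y _; rewrite lee_fin resolvent_ge0.
  + by rewrite lee_fin resolvent_transform_ge0.
- apply/measurable_EFinP; apply: measurable_funM => //.
  exact: (measurableT_comp mh measurable_snd).
- by move=> z; rewrite lee_fin mulr_ge0 ?resolvent_ge0 ?resolvent_transform_ge0.
Qed.

Variable N : R.
Let E : set (measurableTypeR R) := [set x | ~~ (x ^+ 2 <= N)].
Hypotheses (N_gt0 : 0 < N) (E0 : mu E = 0%E).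

(** For l > 0 this is (l + N)^-1, and like [h] it vanishes for l <= 0, so integrals over the line
    see only l > 0. The positive part in [v] keeps the integrand nonnegative off the support too, as
    Tonelli demands. *)
Let r (l : R) : R := resolvent (Num.sqrt N) l.
Let v (x : R) : R := Num.max (N - x ^+ 2) 0.

(* On the support of [mu] this is [\int_0^oo ((l + x ^+ 2)^-1 - (l + N)^-1) dl],
   that is [ln N - ln (x ^+ 2)]. *)
Let W (x : R) : \bar R := (\int[leb]_l (v x * (resolvent x l * r l))%:E)%E.

Let v_ge0 x : 0 <= v x. Proof. by rewrite le_max lexx orbT. Qed.

Let v_le x : v x <= N. Proof. by rewrite ge_max gerBl sqr_ge0 ltW. Qed.

Let sqrtN : Num.sqrt N ^+ 2 = N. Proof. by rewrite sqr_sqrtr// ltW. Qed.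

Let measurable_v : @measurable_fun _ _ (measurableTypeR R) (measurableTypeR R) setT v.
Proof.
by apply: measurable_maxr => //; exact: measurable_funB.
Qed.

Let measurable_integrand : measurable_fun setT
  (fun z : measurableTypeR R * measurableTypeR R => (v z.1 * (resolvent z.1 z.2 * r z.2))%:E).
Proof.
apply/measurable_EFinP; apply: measurable_funM.
  exact: (measurableT_comp measurable_v measurable_fst).
apply: measurable_funM; first exact: measurable_resolvent.
exact: (measurableT_comp (measurable_resolvent2 _) measurable_snd).
Qed.

Let integrand_ge0 x l : 0 <= v x * (resolvent x l * r l).
Proof. by rewrite !mulr_ge0 ?resolvent_ge0. Qed.

Lemma measurable_defect : @measurable_fun _ _ (measurableTypeR R) _ setT W.
Proof.
apply: (measurable_fun_fubini_tonelli_F (m2 := leb) _ measurable_integrand) => z.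
by rewrite lee_fin.
Qed.

Let integral_defect_slice l :
  (\int[mu]_x (v x * (resolvent x l * r l))%:E = (h l - r l)%:E)%E.
Proof.
have [l0|l0] := leP l 0.
  have res0 x : resolvent x l = 0 by rewrite /resolvent ltNge l0.
  rewrite /h resolvent_transform_nonpos// /r res0 subrr.
  by apply: integral0_eq => x _; rewrite !mulr0.
have mE : measurable E := @measurable_square_gt R N.
have mf : mu.-integrable setT (EFin \o (fun x => v x * (resolvent x l * r l))).
  apply: (@bounded_integrable_probability _ _ _ mu _ (N * (l^-1 * l^-1))).
    apply: measurable_funM => //; apply: measurable_funM; first exact: measurable_resolvent1.
    exact: measurable_cst.
  move=> x; rewrite ger0_norm//.
  by rewrite ler_pM ?mulr_ge0 ?resolvent_ge0// ler_pM ?resolvent_ge0 ?resolvent_le.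
have rf : mu.-integrable setT (EFin \o (cst (r l))).
  by apply: (@bounded_integrable_probability _ _ _ mu _ (r l)) => // x; rewrite ger0_norm ?resolvent_ge0.
have hf : mu.-integrable setT (EFin \o (fun x => resolvent x l - r l)).
  rewrite (_ : _ \o _ = (fun x => (EFin \o (fun x => resolvent x l)) x - (EFin \o cst (r l)) x)%E)//.
  by apply: integrableB => //; exact: integrable_resolvent.
transitivity (\int[mu]_x (v x * (resolvent x l * r l)))%:E.
  by rewrite /Rintegral fineK//; exact: integrable_fin_num mf.
congr (_%:E); rewrite (Rintegral_negligible mE E0 mf).
transitivity (\int[mu]_x (resolvent x l - r l)); last first.
  rewrite (@RintegralB _ _ _ mu setT _ (cst (r l)))//; last exact: integrable_resolvent.
  by rewrite Rintegral_cst//= probability_setT mulr1.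
rewrite (Rintegral_negligible mE E0 hf); apply: eq_Rintegral => x.
rewrite inE /E/= => /negP; rewrite negbK => xN.
rewrite /v max_l ?subr_ge0// /r !resolventE// sqrtN.
have lx : l + x ^+ 2 != 0 by rewrite gt_eqF// ltr_pwDl// sqr_ge0.
have lN : l + N != 0 by rewrite gt_eqF// addr_gt0.
by field; rewrite lx lN.
Qed.

Lemma integral_defectE : (\int[mu]_x W x = \int[leb]_l (h l - r l)%:E)%E.
Proof.
rewrite (fubini_tonelli (m1 := mu) (m2 := leb) _ measurable_integrand)/=.
  by apply: eq_integral => l _; rewrite integral_defect_slice.
by move=> z; rewrite lee_fin.
Qed.

Lemma resolvent_defect_ge0 l : 0 <= h l - r l.
Proof.
rewrite -lee_fin -integral_defect_slice.
by apply: integral_ge0 => x _; rewrite lee_fin.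
Qed.

(** Bounding [v] by [N] under the integral gives h - r <= N r h, and r <= h because the defect is
    nonnegative. *)
Lemma resolvent_defect_le l : h l - r l <= N * h l ^+ 2.
Proof.
have hr := resolvent_defect_ge0 l; rewrite subr_ge0 in hr.
have r0 : 0 <= r l := resolvent_ge0 _ l.
have h0 : 0 <= h l := resolvent_transform_ge0 mu l.
apply: (@le_trans _ _ (N * r l * h l)); last first.
  by rewrite -mulrA expr2 ler_wpM2l ?(ltW N_gt0)// ler_wpM2r.
rewrite -lee_fin -integral_defect_slice EFinM -resolvent_intE -ge0_integralZl//.
- apply: ge0_le_integral => //.
  + by move=> x _; rewrite lee_fin.
  + apply/measurable_EFinP; apply: measurable_funM => //; apply: measurable_funM.
      exact: measurable_resolvent1.
    exact: measurable_cst.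
  + apply/measurable_EFinP; apply: measurable_funM => //; exact: measurable_resolvent1.
  + move=> x _; rewrite -EFinM lee_fin (mulrC (resolvent x l)) mulrA.
    by rewrite ler_wpM2r ?resolvent_ge0// ler_wpM2r.
- by apply/measurable_EFinP; exact: measurable_resolvent1.
- by move=> x _; rewrite lee_fin resolvent_ge0.
- by rewrite lee_fin mulr_ge0// ltW.
Qed.

Lemma integral_defect_lty :
  (\int[mu \x mu]_z fisher_kernel z.1 z.2 < +oo -> \int[leb]_l (h l - r l)%:E < +oo)%E.
Proof.
rewrite fisher_integralE => hfin.
have mh := measurable_resolvent_transform.
apply: (@le_lt_trans _ _ (\int[leb]_l (N%:E * (h l ^+ 2)%:E))%E).
  apply: ge0_le_integral => //.
  - by move=> l _; rewrite lee_fin resolvent_defect_ge0.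
  - apply/measurable_EFinP; apply: measurable_funB => //; exact: measurable_resolvent2.
  - by under eq_fun do rewrite -EFinM; apply/measurable_EFinP; apply: measurable_funM => //; exact: measurable_funX.
  - by move=> l _; rewrite -EFinM lee_fin resolvent_defect_le.
rewrite ge0_integralZl//.
- by rewrite lte_mul_pinfty// lee_fin ltW.
- by apply/measurable_EFinP; exact: measurable_funX.
- by move=> l _; rewrite lee_fin sqr_ge0.
- by rewrite lee_fin ltW.
Qed.

(** [W x] is N - x^2 times the kernel at x and sqrt N. At x = 0 the kernel is infinite and both
    sides are -oo; when x^2 = N the factor N - x^2 cancels the diagonal value. *)
Let lne_defect x : x ^+ 2 <= N ->
  (lne (`|x|%:E) = (2^-1)%:E * ((ln N)%:E - W x))%E.
Proof.
move=> xN; have WE : W x = ((N - x ^+ 2)%:E * fisher_kernel x (Num.sqrt N))%E.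
  rewrite fisher_kernelE -ge0_integralZl//.
  - by apply: eq_integral => l _; rewrite EFinM /v max_l ?subr_ge0.
  - apply/measurable_EFinP; apply: measurable_funM; exact: measurable_resolvent2.
  - by move=> l _; rewrite lee_fin mulr_ge0 ?resolvent_ge0.
  - by rewrite lee_fin subr_ge0.
have sN0 : (Num.sqrt N == 0) = false by rewrite gt_eqF// sqrtr_gt0.
rewrite WE /fisher_kernel sqrtN sN0 orbF.
have [->|x0] := eqVneq x 0.
  rewrite normr0 /lne lexx expr0n/= subr0 gt0_muley ?lte_fin//=.
  by rewrite gt0_muleNy// lte_fin invr_gt0.
have x20 : 0 < x ^+ 2 by rewrite exprn_even_gt0.
have lnx : ln (x ^+ 2) = 2 * ln `|x|.
  by rewrite -[x ^+ 2]real_normK ?num_real// lnXn ?normr_gt0// mulr_natl.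
rewrite lne_EFin ?normr_gt0//; case: eqVneq => [e|xN'].
  rewrite e subrr mul0e sube0 -EFinM; congr (_%:E).
  by rewrite -e lnx mulrA mulVf ?mul1r.
rewrite -EFinM; congr (_%:E); rewrite lnx.
by field; rewrite subr_eq0.
Qed.

Lemma entropy_defectE : (\int[leb]_l (h l - r l)%:E < +oo ->
  \int[mu]_x lne (`|x|%:E) = (2^-1)%:E * ((ln N)%:E - \int[leb]_l (h l - r l)%:E))%E.
Proof.
move=> fin.
have W0 x : (0 <= W x)%E by apply: integral_ge0 => l _; rewrite lee_fin.
have iW : mu.-integrable setT W.
  apply/integrableP; split; first exact: measurable_defect.
  under eq_integral do rewrite gee0_abs//.
  by rewrite integral_defectE.
have iN : mu.-integrable setT (EFin \o cst (ln N)).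
  by apply: (@bounded_integrable_probability _ _ _ mu _ `|ln N|).
have iNW : mu.-integrable setT (fun x => (ln N)%:E - W x)%E by exact: integrableB iN iW.
rewrite (@ae_eq_integral _ _ _ mu setT (fun x => (2^-1)%:E * ((ln N)%:E - W x))%E)//.
- rewrite integralZl// (integralB _ iN iW)// integral_defectE.
  by have -> : (\int[mu]_x (EFin \o cst (ln N)) x = (ln N)%:E)%E
    by have := integral_cst mu measurableT (ln N)%:E; rewrite /= probability_setT mule1.
- rewrite (_ : (fun x => _) = (fun x : measurableTypeR R => if x == 0 then -oo%E else (ln `|x|)%:E)).
    apply: measurable_fun_ifT => //; first exact: measurable_fun_eqr.
    apply/measurable_EFinP.
    exact: (measurableT_comp (@measurable_ln R) (@normr_measurable R setT)).
  apply/funext => x; case: eqVneq => [->|x0]; first by rewrite normr0 /lne lexx.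
  by rewrite lne_EFin// normr_gt0.
- by apply: emeasurable_funM => //; case/integrableP: iNW.
- exists E; split => //; first exact: measurable_square_gt.
  move=> x /= hx; apply/negP => xN; apply: hx => _.
  exact: lne_defect.
Qed.

End FisherEntropy.

(** * The flow *)

Section RiccatiIntegral.
Context {R : realType}.
Notation leb := (@lebesgue_measure R).

(* [c / (1 + s c)] solves [u' = - u ^+ 2], [u 0 = c]. *)
Lemma integral_riccati (c t : R) : 0 <= c -> 0 <= t ->
  (\int[leb]_(s in `[0%R, t]) ((c / (1 + s * c)) ^+ 2)%:E = (c - c / (1 + t * c))%:E)%E.
Proof.
move=> c0; rewrite le_eqVlt => /predU1P[<-|t0].
  by rewrite set_itv1 integral_set1 mul0r addr0 divr1 subrr.
have pos (s : R) : 0 <= s -> 1 + s * c != 0.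
  by move=> s0; rewrite gt_eqF// ltr_pwDl// mulr_ge0.
have aff (s : R) : is_derive s 1 (fun u : R => 1 + u * c) c.
  by apply: is_derive_eq; rewrite /GRing.scale/=; ring.
have dF (s : R) : 0 <= s ->
    is_derive s 1 (fun u : R => - (c * (1 + u * c)^-1)) ((c / (1 + s * c)) ^+ 2).
  move=> s0; have d := @is_deriveV _ (fun u : R => 1 + u * c) s _ _ (pos s s0) (aff s).
  apply: is_derive_eq; rewrite /GRing.scale/=; field; exact: pos.
have cF (s : R) : 0 <= s -> {for s, continuous (fun u : R => - (c * (1 + u * c)^-1))}.
  move=> s0; apply: differentiable_continuous; apply/derivable1_diffP.
  by have [] := dF s s0.
rewrite (@continuous_FTC2 _ _ (fun u : R => - (c * (1 + u * c)^-1)))//.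
- by rewrite -EFinB mul0r addr0 invr1 mulr1 opprK addrC.
- apply: continuous_in_subspaceT => s; rewrite inE/= in_itv/= => /andP[s0 _].
  rewrite (_ : (fun _ => _) = (fun u : R => u ^+ 2) \o (fun u : R => - (c * (1 + u * c)^-1))).
    by apply: continuous_comp; [exact: cF|exact: exprn_continuous].
  by apply/funext => u /=; rewrite sqrrN.
- split.
  + by move=> s; rewrite in_itv/= => /andP[s0 _]; have [] := dF s (ltW s0).
  + by apply: cvg_at_right_filter; exact: cF.
  + by apply: cvg_at_left_filter; apply: cF; exact: ltW.
- move=> s; rewrite in_itv/= => /andP[s0 _].
  by rewrite derive1E; have [_ ->] := dF s (ltW s0).
Qed.

End RiccatiIntegral.

Section EntropyAlongFlow.
Context {R : realType} {H : completeNormedModType R[i]}.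
Notation leb := (@lebesgue_measure R).
Variables (dot : {dot H for Num.conj}) (M : set (H -> H)) (tau : (H -> H) -> R[i]).
Hypothesis Mtau : nc_probability_space dot M tau.
Variables (X B : H -> H).
Hypotheses (MX : M X) (saX : selfadjoint dot X) (MB : M B) (saB : selfadjoint dot B).
Hypothesis symX : symmetric_distribution (law tau X).
Hypothesis indep : boolean_independent tau X B.
Hypothesis lawB : symmetric_bernoulli_distribution (law tau B).

Let Xs (s : R) : H -> H := X + (Num.sqrt s)%:C *: B.
Let h (s l : R) : R := resolvent_transform (law tau (Xs s)) l.
Let h0 (l : R) : R := resolvent_transform (law tau X) l.

Let h0_ge0 l : 0 <= h0 l. Proof. exact: resolvent_transform_ge0. Qed.

Let den_gt0 s l : 0 <= s -> 0 < 1 + s * h0 l.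
Proof. by move=> s0; rewrite ltr_pwDl// mulr_ge0. Qed.

Lemma flow0 : X + (Num.sqrt 0)%:C *: B = X.
Proof. by rewrite sqrtr0 scale0r addr0. Qed.

Lemma resolvent_flowE s l : 0 <= s -> h s l = h0 l / (1 + s * h0 l).
Proof.
move=> s0; have [l0|l0] := leP l 0.
  by rewrite /h /h0 !resolvent_transform_nonpos// mul0r.
have := resolvent_equation Mtau (Num.sqrt s) MX saX MB saB symX indep lawB l0.
rewrite -/(Xs s) -/(h s l) -/(h0 l) sqr_sqrtr// => e.
apply/eqP; rewrite eq_sym -subr_eq0; apply/eqP.
have d0 : 1 + s * h0 l != 0 by rewrite gt_eqF// den_gt0.
apply: (mulIf d0); rewrite mul0r mulrBl divfK// mulrDr mulr1 {1}e.
by ring.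
Qed.

(** This is 1 / h s2 - 1 / h s1 = s2 - s1 without divisions, hence valid also where the transforms
    vanish. *)
Lemma resolvent_flow_diff s1 s2 l : 0 <= s1 -> 0 <= s2 ->
  h s1 l - h s2 l = (s2 - s1) * (h s1 l * h s2 l).
Proof.
move=> s10 s20; rewrite !resolvent_flowE//.
have d1 : 1 + s1 * h0 l != 0 by rewrite gt_eqF// den_gt0.
have d2 : 1 + s2 * h0 l != 0 by rewrite gt_eqF// den_gt0.
by field; rewrite d1 d2.
Qed.

Let h_ge0 s l : 0 <= h s l. Proof. exact: resolvent_transform_ge0. Qed.

Let h_diff_ge0 s1 s2 l : 0 <= s1 -> s1 <= s2 -> 0 <= h s1 l - h s2 l.
Proof.
move=> s10 s12; rewrite resolvent_flow_diff//; last exact: le_trans s12.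
by rewrite mulr_ge0 ?subr_ge0// mulr_ge0.
Qed.

Let mh s : measurable_fun setT (h s).
Proof. exact: measurable_resolvent_transform. Qed.

Lemma entropy_increment s1 s2 : 0 <= s1 -> s1 <= s2 ->
  (boolean_fisher tau (Xs s1) < +oo)%E -> (boolean_fisher tau (Xs s2) < +oo)%E ->
  [/\ boolean_entropy tau (Xs s1) \is a fin_num,
      boolean_entropy tau (Xs s2) \is a fin_num,
      (\int[leb]_l (h s1 l - h s2 l)%:E)%E \is a fin_num &
      (boolean_entropy tau (Xs s2) - boolean_entropy tau (Xs s1) =
       (2^-1)%:E * \int[leb]_l (h s1 l - h s2 l)%:E)%E].
Proof.
move=> s10 s12 fin1 fin2.
have MXs s : M (Xs s) by exact: (perturbation_mem Mtau).
have sXs s : selfadjoint dot (Xs s) by exact: perturbation_selfadjoint.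
have [N1 N10 sup1] := law_support Mtau (MXs s1) (sXs s1).
have [N2 N20 sup2] := law_support Mtau (MXs s2) (sXs s2).
(* One [N] for both times makes the two terms [ln N] cancel. *)
pose N := Num.max N1 N2.
have N0 : 0 < N by rewrite lt_max N10.
have E1 : law tau (Xs s1) [set x | ~~ (x ^+ 2 <= N)] = 0%E by apply: sup1; rewrite le_max lexx.
have E2 : law tau (Xs s2) [set x | ~~ (x ^+ 2 <= N)] = 0%E by apply: sup2; rewrite le_max lexx orbT.
pose r (l : R) := resolvent (Num.sqrt N) l.
pose I1 := (\int[leb]_l (h s1 l - r l)%:E)%E.
pose I2 := (\int[leb]_l (h s2 l - r l)%:E)%E.
have D1 : (I1 < +oo)%E by exact: (integral_defect_lty N0 E1 fin1).
have D2 : (I2 < +oo)%E by exact: (integral_defect_lty N0 E2 fin2).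
have -> : boolean_entropy tau (Xs s1) = ((2^-1)%:E * ((ln N)%:E - I1))%E.
  exact: (entropy_defectE N0 E1 D1).
have -> : boolean_entropy tau (Xs s2) = ((2^-1)%:E * ((ln N)%:E - I2))%E.
  exact: (entropy_defectE N0 E2 D2).
have r2 l : 0 <= h s2 l - r l by exact: (resolvent_defect_ge0 N0 E2).
have I10 : (0 <= I1)%E.
  by apply: integral_ge0 => l _; rewrite lee_fin; exact: (resolvent_defect_ge0 N0 E1).
have I20 : (0 <= I2)%E by apply: integral_ge0 => l _; rewrite lee_fin r2.
pose J := (\int[leb]_l (h s1 l - h s2 l)%:E)%E.
have J0 : (0 <= J)%E by apply: integral_ge0 => l _; rewrite lee_fin h_diff_ge0.
(* Stated as a sum of nonnegative integrals, so that finiteness of [I1] bounds [J] before anything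
   is subtracted in [\bar R]. *)
have I1E : I1 = (J + I2)%E.
  rewrite /J /I2 -ge0_integralD//.
  - by apply: eq_integral => l _; rewrite -EFinD; congr (_%:E); rewrite addrA subrK.
  - by move=> l _; rewrite lee_fin h_diff_ge0.
  - by apply/measurable_EFinP; apply: measurable_funB; exact: mh.
  - by move=> l _; rewrite lee_fin r2.
  - apply/measurable_EFinP; apply: measurable_funB; [exact: mh|exact: measurable_resolvent2].
have fI2 : I2 \is a fin_num by rewrite (ge0_fin_numE I20).
have JI1 : (J <= I1)%E by rewrite I1E leeDl.
have fJ : J \is a fin_num.
  rewrite (ge0_fin_numE J0); exact: (le_lt_trans JI1 D1).
rewrite -/J I1E; clear - fI2 fJ; clearbody I2 J.
case: I2 fI2 => // i2 _; case: J fJ => // j _; split => //.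
transitivity (2^-1 * (ln N - i2) - 2^-1 * (ln N - (j + i2)))%:E; first by [].
by rewrite -EFinM; congr (_%:E); ring.
Qed.

Lemma fisher_flowE s : 0 <= s -> ((2^-1)%:E * boolean_fisher tau (Xs s) =
  \int[leb]_l (2^-1 * (h0 l / (1 + s * h0 l)) ^+ 2)%:E)%E.
Proof.
move=> s0; rewrite /boolean_fisher fisher_integralE -ge0_integralZl//.
- by apply: eq_integral => l _; rewrite EFinM -resolvent_flowE.
- by apply/measurable_EFinP; apply: measurable_funX; exact: mh.
- by move=> l _; rewrite lee_fin sqr_ge0.
Qed.

Lemma integral_fisher_flow t : 0 <= t ->
  (\int[leb]_(s in `[0%R, t]) ((2^-1)%:E * boolean_fisher tau (Xs s)) =
   (2^-1)%:E * \int[leb]_l (h 0 l - h t l)%:E)%E.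
Proof.
move=> t0; have mh0 : measurable_fun setT h0 by exact: measurable_resolvent_transform.
(* The indicator of [0, t] is built in so that Tonelli applies on the whole plane. *)
pose f (z : measurableTypeR R * measurableTypeR R) : R :=
  (if (0 <= z.1) && (z.1 <= t) then 1 else 0) * (2^-1 * (h0 z.2 / (1 + z.1 * h0 z.2)) ^+ 2).
have f0 z : 0 <= f z.
  apply: mulr_ge0; first by case: ifP.
  by rewrite mulr_ge0 ?invr_ge0 ?sqr_ge0.
have mf : measurable_fun setT f.
  have mh02 : measurable_fun setT (fun z : measurableTypeR R * measurableTypeR R => h0 z.2).
    exact: (measurableT_comp mh0 measurable_snd).
  apply: measurable_funM.
    apply: measurable_fun_ifT => //.
    by apply: measurable_and; apply: measurable_fun_ler => //; exact: measurable_fst.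
  apply: measurable_funM => //; apply: measurable_funX; apply: measurable_funM => //.
  apply: measurable_inv; apply: measurable_funD => //; apply: measurable_funM => //.
transitivity (\int[leb]_s \int[leb]_l (f (s, l))%:E)%E.
  rewrite integral_mkcond; apply: eq_integral => s _.
  rewrite /patch mem_setE in_itv/= /f/=; case: ifPn => [/andP[s0 _]|_].
    by rewrite fisher_flowE//; apply: eq_integral => l _; rewrite mul1r.
  by rewrite integral0_eq// => l _; rewrite mul0r.
rewrite (fubini_tonelli (m1 := leb) (m2 := leb) (fun z => (f z)%:E))/=; last 2 first.
- exact/measurable_EFinP.
- by move=> z; rewrite lee_fin.
rewrite -ge0_integralZl//; last 2 first.
- by apply/measurable_EFinP; apply: measurable_funB; exact: mh.
- by move=> l _; rewrite lee_fin h_diff_ge0.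
apply: eq_integral => l _.
transitivity (\int[leb]_(s in `[0%R, t]) ((2^-1)%:E * ((h0 l / (1 + s * h0 l)) ^+ 2)%:E))%E.
  rewrite [RHS]integral_mkcond; apply: eq_integral => s _.
  rewrite /patch mem_setE in_itv/= /f/=; case: ifP => _; last by rewrite mul0r.
  by rewrite mul1r EFinM.
rewrite ge0_integralZl//.
- by rewrite integral_riccati// !resolvent_flowE// mul0r addr0 divr1.
- apply/measurable_EFinP; apply: measurable_funTS; apply: measurable_funX.
  apply: measurable_funM => //; apply: measurable_inv; apply: measurable_funD => //.
  exact: measurable_funM.
- by move=> s _; rewrite lee_fin sqr_ge0.
Qed.

Lemma integral_flow_diff_gt0 s1 s2 : 0 <= s1 -> s1 < s2 ->
  (0 < \int[leb]_l (h s1 l - h s2 l)%:E)%E.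
Proof.
move=> s10 s12.
have s20 : 0 <= s2 by rewrite (le_trans s10)// ltW.
have [N N0 sup] := law_support Mtau MX saX.
have E0 := sup N (lexx _).
(* For l in [1, 2] one has (2 + N)^-1 <= h0 l <= 1, so h0 l / (1 + s h0 l) >= c whenever 0 <= s <=
   s2. *)
pose c := (2 + N)^-1 / (1 + s2).
have c0 : 0 < c.
  apply: divr_gt0; first by rewrite invr_gt0 addr_gt0.
  by rewrite ltr_pwDl.
have hc s l : 0 <= s -> s <= s2 -> 1 <= l -> l <= 2 -> c <= h s l.
  move=> sn ss l1 l2; rewrite resolvent_flowE//.
  have l0 : 0 < l by rewrite (lt_le_trans ltr01).
  have hl : (2 + N)^-1 <= h0 l.
    apply: le_trans (resolvent_transform_ge N0 E0 l0).
    by rewrite lef_pV2 ?posrE ?addr_gt0// lerD2r.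
  have hu : h0 l <= 1.
    apply: (@le_trans _ _ (\int[law tau X]_x 1)); last first.
      by rewrite Rintegral_cst//= probability_setT mulr1.
    apply: le_Rintegral => //.
    - exact: integrable_resolvent.
    - by apply: (@bounded_integrable_probability _ _ _ _ (cst 1) 1) => // x; rewrite normr1.
    - move=> x _; rewrite (le_trans (resolvent_le x l0))//.
      by rewrite invf_le1.
  rewrite /c ler_pM ?invr_ge0 ?addr_ge0 ?(ltW N0)//.
  rewrite lef_pV2 ?posrE ?den_gt0 ?ltr_pwDl// lerD2l.
  by rewrite (le_trans (ler_wpM2l sn hu))// mulr1.
have d0 : 0 < (s2 - s1) * (c * c) by rewrite mulr_gt0 ?subr_gt0// mulr_gt0.
apply: (@lt_le_trans _ _ (\int[leb]_(l in `[1%R, 2%R]) ((s2 - s1) * (c * c))%:E)%E).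
  rewrite integral_cst//= lebesgue_measure_itv/= lte_fin ltr1n -EFinB -EFinM lte_fin.
  by rewrite mulr_gt0// subr_gt0 ltr1n.
apply: (@le_trans _ _ (\int[leb]_(l in `[1%R, 2%R]) (h s1 l - h s2 l)%:E)%E).
  apply: ge0_le_integral => //.
  - by move=> l _; rewrite lee_fin ltW.
  - by apply/measurable_EFinP; apply: measurable_funTS; apply: measurable_funB; exact: mh.
  - move=> l /=; rewrite in_itv/= => /andP[l1 l2]; rewrite lee_fin resolvent_flow_diff//.
    rewrite ler_wpM2l ?subr_ge0 ?(ltW s12)// ler_pM ?(ltW c0) ?hc//; exact: ltW.
apply: ge0_subset_integral => //.
- by apply/measurable_EFinP; apply: measurable_funB; exact: mh.
- by move=> l _; rewrite lee_fin h_diff_ge0// ltW.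
Qed.

End EntropyAlongFlow.

Unset Implicit Arguments.
Set Strict Implicit.
Set Printing Implicit Defensive.

Theorem theorem1p3 (R : realType) (H : completeNormedModType R[i])
    (dot : {dot H for Num.conj}) (M : set (H -> H)) (tau : (H -> H) -> R[i])
    (Mtau : nc_probability_space dot M tau)
    (X B : H -> H)
    (MX : M X) (saX : selfadjoint dot X)
    (symX : symmetric_distribution (law tau X))
    (MB : M B) (saB : selfadjoint dot B)
    (indep : boolean_independent tau X B)
    (lawB : symmetric_bernoulli_distribution (law tau B))
    (t : R) (t_ge0 : 0 <= t)
    (finite_entropy : forall s : R, 0 <= s <= t ->
      (boolean_entropy tau (X + (Num.sqrt s)%:C *: B)%R < +oo)%E)
    (finite_fisher : forall s : R, 0 <= s <= t ->
      (boolean_fisher tau (X + (Num.sqrt s)%:C *: B)%R < +oo)%E) :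
  (boolean_entropy tau (X + (Num.sqrt t)%:C *: B)%R - boolean_entropy tau X =
    \int[lebesgue_measure]_(s in `[0%R, t])
      ((2^-1)%:E * boolean_fisher tau (X + (Num.sqrt s)%:C *: B)%R))%E /\
  (forall s1 s2 : R, 0 <= s1 -> s1 < s2 -> s2 <= t ->
    (boolean_entropy tau (X + (Num.sqrt s1)%:C *: B)%R <
     boolean_entropy tau (X + (Num.sqrt s2)%:C *: B)%R)%E).
Proof.
have X0 := flow0 X B.
have fisher s : 0 <= s -> s <= t ->
    (boolean_fisher tau (X + (Num.sqrt s)%:C *: B)%R < +oo)%E.
  by move=> s0 st; apply: finite_fisher; rewrite s0 st.
have incr s1 s2 := entropy_increment Mtau MX saX MB saB symX indep lawB (s1 := s1) (s2 := s2).
split.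
  have [_ _ _] := incr 0 t (lexx _) t_ge0 (fisher _ (lexx _) t_ge0) (fisher _ t_ge0 (lexx _)).
  have := integral_fisher_flow Mtau MX saX MB saB symX indep lawB t_ge0.
  by rewrite X0 => -> ->.
move=> s1 s2 s10 s12 s2t; have s20 : 0 <= s2 by rewrite (le_trans s10)// ltW.
have [f1 f2 fJ e] := incr s1 s2 s10 (ltW s12)
  (fisher _ s10 (le_trans (ltW s12) s2t)) (fisher _ s20 s2t).
rewrite -sube_gt0 e mule_gt0// ?lte_fin ?invr_gt0//.
exact: (integral_flow_diff_gt0 Mtau MX saX MB saB symX indep lawB s10 s12).
Qed.
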